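(* Assume that $H(a,\alpha)<\infty$ for all $(a,\alpha)\in\mathbb{R}^{h+m}$, that $(\bar W,\rho_k,\bar a_k)$ (with $1\le k\le K$) is a generalized subsolution/control to the Isaacs equation $$W_t(y,t)+\sup_{a\in\mathbb{R}^h}\inf_{(b,\beta)\in\mathbb{R}^{h+m}}\mathbb{H}(DW(y,t),a,b,\beta)=0,$$ that $\bar W(y,1)\le 2F(y)$ for all $y\in\mathbb{R}^m$, and that, for each $n\in\mathbb{N}$, $Z^n$ is the importance sampling estimator $$Z^n=e^{-nF(\bar Y^n_n)}\prod_{j=0}^{n-1}\left[\sum_{k=1}^{K}\rho_k(\bar Y^n_j,j/n)\,e^{\langle \bar a_k(\bar Y^n_j,j/n),\bar X^n_{j+1}\rangle-H_1(\bar a_k(\bar Y^n_j,j/n))}\right]^{-1},$$ where $\{\bar X^n_j\}_{1\le j\le n}$ and $\{\bar Y^n_j\}_{0\le j\le n}$ are generated from $(\rho_k,\bar a_k)$ by the sampling scheme described in the context. Then $$\liminf_{n\to\infty}-\frac1n\log\mathbb{E}\left[(Z^n)^2\right]\ge \bar W(0,0).$$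
   Context: Setting. $X_1,X_2,\dots$ are i.i.d. random variables in $\mathbb{R}^h$ with distribution $\eta$; $G:\mathbb{R}^h\to\mathbb{R}^m$ is continuous; $F:\mathbb{R}^m\to\mathbb{R}\cup\{\infty\}$ is measurable (with $e^{-\infty}=0$). Notation. For $(a,\alpha)\in\mathbb{R}^{h+m}$ ($a\in\mathbb{R}^h$, $\alpha\in\mathbb{R}^m$), $H(a,\alpha)=\log\mathbb{E}[e^{\langle a,X_1\rangle+\langle\alpha,G(X_1)\rangle}]$, and $H_1(a)=H(a,0)$. The Legendre transform of $H$ is $L(b,\beta)=\sup_{(a,\alpha)\in\mathbb{R}^{h+m}}\big(\langle a,b\rangle+\langle\alpha,\beta\rangle-H(a,\alpha)\big)$ for $(b,\beta)\in\mathbb{R}^{h+m}$ (possibly $+\infty$). For $s,\beta\in\mathbb{R}^m$, $a,b\in\mathbb{R}^h$, $$\mathbb{H}(s,a,b,\beta)=\langle a,b\rangle+\langle s,\beta\rangle+L(b,\beta)-H_1(a).$$ For a function $W$ of $(y,t)\in\mathbb{R}^m\times[0,1]$, $W_t$ and $DW$ denote the derivatives with respect to $t$ and $y$. Generalized subsolution/control. Given $K\in\mathbb{N}$ and functions $\bar W:\mathbb{R}^m\times[0,1]\to\mathbb{R}$, $\rho_k:\mathbb{R}^m\times[0,1]\to\mathbb{R}$, $\bar a_k:\mathbb{R}^m\times[0,1]\to\mathbb{R}^h$, $1\le k\le K$, the collection $(\bar W,\rho_k,\bar a_k)$ is a generalized subsolution/control to the Isaacs equation if: (i) $\rho_k(y,t)\ge0$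 for all $k$ and $\sum_{k=1}^K\rho_k(y,t)=1$ for all $(y,t)\in\mathbb{R}^m\times[0,1]$; (ii) $\bar W$ is continuously differentiable and there are functions $r_k:\mathbb{R}^m\times[0,1]\to\mathbb{R}$ and $s_k:\mathbb{R}^m\times[0,1]\to\mathbb{R}^m$ with $\bar W_t(y,t)=\sum_{k=1}^K\rho_k(y,t)r_k(y,t)$ and $D\bar W(y,t)=\sum_{k=1}^K\rho_k(y,t)s_k(y,t)$; (iii) for each $k$ and all $(y,t)$, $r_k(y,t)+\inf_{(b,\beta)\in\mathbb{R}^{h+m}}\mathbb{H}(s_k(y,t),\bar a_k(y,t),b,\beta)\ge0$; (iv) the functions $r_k,s_k,\rho_k,\bar a_k$ are uniformly bounded and continuous. Sampling scheme. Fix $n$. Set $\bar Y^n_0=0$. For $j=0,\dots,n-1$, having constructed $\bar X^n_1,\dots,\bar X^n_j$ and $\bar Y^n_0,\dots,\bar Y^n_j$, generate a random index $I\in\{1,\dots,K\}$ with conditional probabilities $\mathbb{P}[I=k]=\rho_k(\bar Y^n_j,j/n)$; then sample $\bar X^n_{j+1}$ (conditionally on the past and on $I$) from the distribution $e^{\langle\bar a_I(\bar Y^n_j,j/n),x\rangle-H_1(\bar a_I(\bar Y^n_j,j/n))}\eta(dx)$, and set $\bar Y^n_{j+1}=\bar Y^n_j+\frac1nG(\bar X^n_{j+1})$. *)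

(* Defs.v *)
From HB Require Import structures.
From mathcomp Require Import all_boot all_order all_algebra.
From mathcomp Require Import all_classical all_reals all_analysis.
From mathcomp Require Import measurable_realfun.

Set Implicit Arguments.
Unset Strict Implicit.
Unset Printing Implicit Defensive.

Import Order.TTheory GRing.Theory Num.Theory.
Import numFieldNormedType.Exports.

Local Open Scope classical_set_scope.
Local Open Scope ring_scope.

(* R^n with its Borel sigma-algebra; convertible to 'rV[R]_n. *)
Notation borel_rV R n := (g_sigma_algebraType (@open 'rV[R]_n)).

Definition dot {R : realType} {n : nat} (u v : 'rV[R]_n) : R :=
  \sum_(i < n) u ord0 i * v ord0 i.

Section LogMGF.
Context {R : realType} {h m : nat}.
Variables (eta : probability (borel_rV R h) R) (G : 'rV[R]_h -> 'rV[R]_m).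

Definition logmgf (a : 'rV[R]_h) (alpha : 'rV[R]_m) : \bar R :=
  lne 'E_eta[fun x => expR (dot a x + dot alpha (G x))].

Definition logmgf1 (a : 'rV[R]_h) : \bar R := logmgf a 0.

Definition legendre (b : 'rV[R]_h) (beta : 'rV[R]_m) : \bar R :=
  ereal_sup [set (dot q.1 b + dot q.2 beta)%:E - logmgf q.1 q.2
            | q in [set: 'rV[R]_h * 'rV[R]_m]]%E.

Definition hamiltonian (s : 'rV[R]_m) (a b : 'rV[R]_h) (beta : 'rV[R]_m) :
    \bar R :=
  ((dot a b)%:E + (dot s beta)%:E + legendre b beta - logmgf1 a)%E.

(* The use of fine is harmless when H is finite everywhere, which the theorem
   assumes (H never takes the value -oo, the expectation being positive). *)
Definition tilt_density (a x : 'rV[R]_h) : R :=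
  expR (dot a x - fine (logmgf1 a)).

Definition tilted (a : 'rV[R]_h) (B : set (borel_rV R h)) : \bar R :=
  (\int[eta]_(x in B) (tilt_density a x)%:E)%E.

End LogMGF.

Section Subsolution.
Context {R : realType} {h m : nat}.

Definition strip : set ('rV[R]_m * R) := [set: 'rV[R]_m] `*` `[0, 1].

(* Derivatives of functions on [0, 1], one-sided at the endpoints. *)
Definition diff_quotient01 (f : R -> R) (t : R) :=
  (f u - f t) / (u - t) @[u --> within `[0, 1] t^'].

Definition Dt (W : 'rV[R]_m * R -> R) (p : 'rV[R]_m * R) : R :=
  lim (diff_quotient01 (fun u => W (p.1, u)) p.2).

Definition Dy (W : 'rV[R]_m * R -> R) (p : 'rV[R]_m * R) : 'rV[R]_m :=
  \row_(i < m) 'D_(delta_mx ord0 i) (fun y => W (y, p.2)) p.1.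

Definition C1_strip (W : 'rV[R]_m * R -> R) : Prop :=
  [/\ {within strip, continuous W},
      forall p, strip p -> differentiable (fun y => W (y, p.2)) p.1,
      forall p, strip p -> cvg (diff_quotient01 (fun u => W (p.1, u)) p.2),
      {within strip, continuous (Dy W)} &
      {within strip, continuous (Dt W)}].

Variables (eta : probability (borel_rV R h) R) (G : 'rV[R]_h -> 'rV[R]_m).

(* Only the values on the strip R^m x [0, 1] matter. *)
Record generalized_subsolution (K : nat) (W : 'rV[R]_m * R -> R)
    (rho : 'I_K -> 'rV[R]_m * R -> R)
    (abar : 'I_K -> 'rV[R]_m * R -> 'rV[R]_h) : Prop := {
  gs_rho_ge0 : forall k p, strip p -> 0 <= rho k p ;
  gs_rho_sum1 : forall p, strip p -> \sum_(k < K) rho k p = 1 ;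
  gs_C1 : C1_strip W ;
  gs_rs : exists (r : 'I_K -> 'rV[R]_m * R -> R)
                 (s : 'I_K -> 'rV[R]_m * R -> 'rV[R]_m),
    [/\ forall p, strip p -> Dt W p = \sum_(k < K) rho k p * r k p,
        forall p, strip p -> Dy W p = \sum_(k < K) rho k p *: s k p,
        forall k p, strip p ->
          (0 <= (r k p)%:E +
             ereal_inf [set hamiltonian eta G (s k p) (abar k p) q.1 q.2
                       | q in [set: 'rV[R]_h * 'rV[R]_m]])%E,
        exists M : R, forall k p, strip p ->
          [/\ `|r k p| <= M, `|s k p| <= M, `|rho k p| <= M & `|abar k p| <= M] &
        forall k,
          [/\ {within strip, continuous (r k)}, {within strip, continuous (s k)},
              {within strip, continuous (rho k)} &
              {within strip, continuous (abar k)}]] }.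

End Subsolution.

Section Sampling.
Context {R : realType} {h m : nat}.
Variables (eta : probability (borel_rV R h) R) (G : 'rV[R]_h -> 'rV[R]_m).
Variables (K : nat) (rho : 'I_K -> 'rV[R]_m * R -> R)
  (abar : 'I_K -> 'rV[R]_m * R -> 'rV[R]_h).
Variables (n : nat) (d : measure_display) (Omega : measurableType d)
  (P : probability Omega R).

(* X j stands for the j-th sample for 1 <= j <= n; the other X j are unused.
   I j, for j < n, is the index drawn in order to generate X j.+1. *)
Variables (X : nat -> {RV P >-> borel_rV R h}) (I : nat -> Omega -> 'I_K).

Fixpoint Ybar (j : nat) (w : Omega) : 'rV[R]_m :=
  if j is i.+1 then Ybar i w + n%:R^-1 *: G (X i.+1 w) else 0.

Definition state (j : nat) (w : Omega) : 'rV[R]_m * R :=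
  (Ybar j w, j%:R / n%:R).

(* sigma(X_1, ..., X_j), with respect to which Y_0, ..., Y_j are measurable. *)
Definition past (j : nat) : set (set Omega) :=
  <<s [set A | exists i (B : set (borel_rV R h)),
        [/\ (0 < i <= j)%N, measurable B & A = X i @^-1` B]] >>.

(* The conditional laws given the past, in integrated form:
   P[I_j = k | past] = rho_k(Y_j, j/n), and, given the past and I_j = k,
   X_{j+1} has law tilted (abar_k(Y_j, j/n)). *)
Record sampling_scheme : Prop := {
  ss_index_measurable : forall j k, (j < n)%N ->
    measurable (I j @^-1` [set k]) ;
  ss_index_law : forall j k A, (j < n)%N -> past j A ->
    P (A `&` I j @^-1` [set k]) =
      (\int[P]_(w in A) (rho k (state j w))%:E)%E ;
  ss_sample_law : forall j k A (B : set (borel_rV R h)),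
    (j < n)%N -> past j A -> measurable B ->
    P (A `&` I j @^-1` [set k] `&` X j.+1 @^-1` B) =
      (\int[P]_(w in A `&` I j @^-1` [set k])
          tilted eta G (abar k (state j w)) B)%E }.

(* When F y > -oo, expeR (- (n * F y)) is finite, and is 0 if F y = +oo. *)
Definition estimator (F : 'rV[R]_m -> \bar R) (w : Omega) : R :=
  fine (expeR (- (n%:R%:E * F (Ybar n w))))%E *
  \prod_(0 <= j < n)
    (\sum_(k < K) rho k (state j w) *
       tilt_density eta G (abar k (state j w)) (X j.+1 w))^-1.

End Sampling.

(* Main.v *)
From HB Require Import structures.
Require Import Defs.
From mathcomp Require Import all_boot all_order all_algebra.
From mathcomp Require Import all_classical all_reals all_analysis.
From mathcomp Require Import measurable_realfun.
From mathcomp Require Import ring lra.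
Import Order.TTheory GRing.Theory Num.Theory.
Import numFieldNormedType.Exports.
Local Open Scope classical_set_scope.
Local Open Scope ring_scope.

(** The estimator's second moment is dominated by an exponential
supermartingale built from the subsolution.

Write l(y, t, x) = sum_k rho_k(y, t) exp(<a_k(y, t), x> - H_1(a_k(y, t))).
Given the past, the next sample has density l(Y_j, j/n, .) with respect to eta
([expectation_conditional_law]).  The squared estimator carries a factor l^-2
for each step, and integrating against that density absorbs one of the two:
conditionally on the past, f(X_{j+1}) l^-2 has mean
int f(x) l(Y_j, j/n, x)^-1 eta(dx).  Take for f the ratio
exp(- n (W(y + G(x)/n, t + 1/n) - W(y, t))), which for large n is close to
exp(- W_t - <DW, G(x)>) = exp(- sum_k rho_k (r_k + <s_k, G(x)>)).  Two uses of
the convexity of exp bound f / l by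
  sum_k rho_k exp(- r_k - <s_k, G(x)> - <a_k, x> + H_1(a_k)),
whose integral is sum_k rho_k exp(- r_k + H(- a_k, - s_k) + H_1(a_k)).  Every
exponent here is nonpositive: this is condition (iii) of a subsolution, combined
with inf_(b, beta) (<a, b> + <s, beta> + L(b, beta)) <= - H(- a, - s).  The
latter inequality only asks for a subgradient of H at (- a, - s), and the mean
of (x, G(x)) under the exponentially tilted law is one, by Jensen's inequality
([logmgf_subgradient], [hamiltonian_inf_le]).  Hence exp(- n W(Y_j, j/n))
times the product of the first j factors l^-2 is a supermartingale up to a
factor e^eps per step, and the terminal condition W(., 1) <= 2 F gives
E[Z^2] <= exp(- n W(0, 0) + n eps), roughly.

What makes this rigorous is a control of large values.  The expansion of W is
uniform only for y and G(x) in a bounded set.  Large G(x) are harmless: W is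
globally Lipschitz, since r_k and s_k are bounded, and G(X) has all exponential
moments, so the integrands have a common integrable envelope
([step_weight_envelope]).  For large y the step may lose a constant factor
instead of e^eps.  This is compensated in the [potential] by adding to
e^{(n-j) eps} the term e^{n (|y| - C) + (n-j) C}: it loses at most a factor e^C
per step everywhere, which its (n-j) C pays for, it dominates the first term as
soon as |y| > C, and it equals 1 at the starting point y = 0, j = 0. *)

Set Implicit Arguments.
Unset Strict Implicit.
Unset Printing Implicit Defensive.

(** * Elementary inequalities *)

Section arithmetic.
Context {R : realType}.
Implicit Types u M : R.

Lemma fenchel_arith (p q u v : R) :
  u + v + (- u + - v - p) - q <= - p - q.
Proof. lra. Qed.

Lemma subgradient_arith (p q u u' v v' : R) :
  p + (u' - u + (v' - v)) <= q -> u' + v' - q <= u + v - p.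
Proof. lra. Qed.

Lemma isaacs_arith (r p q : R) : 0 <= r + (- p - q) -> p + q <= r.
Proof. lra. Qed.

Lemma expR_bound_arith (D e : R) : 0 <= D -> 0 < e -> 2 * D <= 1 + (2 * D + e).
Proof. lra. Qed.

Lemma envelope_arith M Hmax u1 u2 u3 u4 u5 u6 : 0 <= u5 -> 0 <= u2 -> 0 <= u1 ->
  u4 + M + (u3 + Hmax) + u6 <= M + Hmax + (u3 + u2 + u5 + (u1 + u4 + u6)).
Proof. lra. Qed.

Lemma uniform_arith u (d : R) : 0 < d -> 0 <= u -> u * d <= d / 2 * (2 * (u + 1)).
Proof. move=> d0 u0; nra. Qed.

Lemma near_arith (a1 a2 a3 a4 d : R) : a1 - a2 <= d / 2 -> a3 - a4 < d / 2 ->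
  a1 + a3 - d <= a2 + a4.
Proof. lra. Qed.

End arithmetic.

Section finite_jensen.
Context {R : realType} (K : nat).
Implicit Types p u : 'I_K -> R.

(** Jensen: average the tangent line e^c (1 + (u - c)) <= e^u taken at the mean c. *)
Lemma expR_convex_sum p u : (forall k, 0 <= p k) -> \sum_k p k = 1 ->
  expR (\sum_k p k * u k) <= \sum_k p k * expR (u k).
Proof.
move=> p0 p1; set c := \sum_k p k * u k.
have -> : expR c = \sum_k p k * (expR c * (1 + (u k - c))).
  under eq_bigr do rewrite mulrCA.
  rewrite -mulr_sumr -[LHS]mulr1; congr (_ * _).
  under eq_bigr do rewrite mulrDr mulr1 mulrBr.
  by rewrite big_split/= p1 sumrB -mulr_suml p1 mul1r -/c subrr addr0.
apply: ler_sum => k _; rewrite ler_wpM2l//.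
have -> : expR (u k) = expR c * expR (u k - c) by rewrite -expRD addrC subrK.
by rewrite ler_wpM2l ?expR_ge0// expR_ge1Dx.
Qed.

Lemma mixture_gt0 p u : (forall k, 0 <= p k) -> \sum_k p k = 1 ->
  0 < \sum_k p k * expR (u k).
Proof.
by move=> p0 p1; apply: lt_le_trans (expR_convex_sum u p0 p1); exact: expR_gt0.
Qed.

(** Jensen's inequality twice: the mixture is bounded below by the exponential of
the mean of v, after which a single exponential of a mean remains to be bounded
above. *)
Lemma expR_div_mixture p u v : (forall k, 0 <= p k) -> \sum_k p k = 1 ->
  expR (- \sum_k p k * u k) * (\sum_k p k * expR (v k))^-1 <=
  \sum_k p k * expR (- u k - v k).
Proof.
move=> p0 p1.
apply: le_trans (expR_convex_sum (fun k => - u k - v k) p0 p1).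
under [X in _ <= expR X]eq_bigr do rewrite mulrBr mulrN.
rewrite sumrB sumrN expRD ler_wpM2l ?expR_ge0// expRN.
by rewrite lef_pV2 ?posrE ?expR_gt0 ?mixture_gt0// expR_convex_sum.
Qed.

End finite_jensen.

(** * Integration *)

Section integral_monotone.
Local Open Scope ereal_scope.
Context d (T : measurableType d) (R : realType) (mu : {measure set T -> \bar R}).

Import HBNNSimple.

(** The integral of a nonnegative function is a supremum over the simple functions
below it, so monotonicity holds for arbitrary, possibly non-measurable, f and g. *)
Lemma ge0_integral_monotone (f g : T -> \bar R) :
  (forall x, setT x -> 0 <= f x <= g x) -> \int[mu]_x f x <= \int[mu]_x g x.
Proof.
move=> fg; have f0 x : 0 <= f x by have /andP[] := fg x I.
have g0 x : 0 <= g x by have /andP[] := fg x I; exact: le_trans.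
rewrite !ge0_integralTE//; apply: ereal_sup_le => _ [k /= kf <-].
by exists k => // x; apply: le_trans (kf x) _; have /andP[] := fg x I.
Qed.

End integral_monotone.

Section integrable_real.
Context d (T : measurableType d) (R : realType).
Variable mu : {measure set T -> \bar R}.
Local Notation intg f := (mu.-integrable setT (EFin \o f)).

Lemma integrable_scale (c : R) (f : T -> R) : intg f -> intg (fun x => c * f x).
Proof. by move=> fi; exact: (integrableZl measurableT c fi). Qed.

Lemma integrable_add (f g : T -> R) : intg f -> intg g -> intg (fun x => f x + g x).
Proof. by move=> fi gi; exact: (integrableD measurableT fi gi). Qed.

Lemma integrable_bigsum (I : Type) (s : seq I) (F : I -> T -> R) :
  (forall i, intg (F i)) -> intg (fun x => \sum_(i <- s) F i x).
Proof.
move=> Fi; have := @integrable_sum _ _ _ mu setT measurableT _ s xpredT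
  (fun i => EFin \o F i) (fun i _ => Fi i).
by apply: eq_integrable => // x _ /=; rewrite sumEFin.
Qed.

Lemma Rintegral_sum (I : Type) (s : seq I) (F : I -> T -> R) :
  (forall i, intg (F i)) ->
  \int[mu]_x (\sum_(i <- s) F i x) = \sum_(i <- s) \int[mu]_x F i x.
Proof.
move=> iF; elim: s => [|i s ih].
  rewrite big_nil; under eq_Rintegral do rewrite big_nil.
  by rewrite Rintegral_cst// mul0r.
rewrite big_cons -ih -RintegralD//; last exact: integrable_bigsum.
by apply: eq_Rintegral => x _; rewrite big_cons.
Qed.

Lemma integrable_le (f g : T -> R) : measurable_fun setT f ->
  (forall x, 0 <= f x <= g x) -> intg g -> intg f.
Proof.
move=> mf fg; apply: le_integrable => //; first exact/measurable_EFinP.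
move=> x _ /=; have /andP[f0 fgx] := fg x.
by rewrite lee_fin !ger0_norm// (le_trans f0).
Qed.

End integrable_real.

Section density.
Local Open Scope ereal_scope.
Context d (T : measurableType d) (R : realType).
Variables (mu : {measure set T -> \bar R}) (g : T -> R).
Hypotheses (mg : measurable_fun setT g) (g0 : forall x, (0 <= g x)%R).

Lemma density_measure_exists :
  exists nu : {measure set T -> \bar R},
    forall A, nu A = \int[mu]_(x in A) (g x)%:E.
Proof.
pose m (A : set T) := \int[mu]_(x in A) (g x)%:E.
have m0 : m set0 = 0 by rewrite /m integral_set0.
have mge0 A : 0 <= m A by apply: integral_ge0 => x _; rewrite lee_fin.
have msa : semi_sigma_additive m.
  move=> F mF tF mUF; apply: cvg_toP.
    apply: ereal_nondecreasing_is_cvgn => p q pq.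
    by apply: lee_sum_nneg_natr => // k _ _.
  rewrite /m ge0_integral_bigcup//.
    exact/measurable_funTS/measurable_EFinP.
  by move=> x _; rewrite lee_fin.
pose mm := isMeasure.Build _ _ _ m m0 mge0 msa.
pose nu : {measure set T -> \bar R} := HB.pack m mm.
by exists nu.
Qed.

Import HBNNSimple.

(** Proved on simple functions, then by monotone convergence on both sides. *)
Lemma ge0_integral_density (nu : {measure set T -> \bar R}) (f : T -> \bar R) :
  (forall A, measurable A -> nu A = \int[mu]_(x in A) (g x)%:E) ->
  measurable_fun setT f -> (forall x, 0 <= f x) ->
  \int[nu]_x f x = \int[mu]_x (f x * (g x)%:E).
Proof.
move=> nuE mf f0.
have mgE : measurable_fun setT (EFin \o g) by exact/measurable_EFinP.
pose f_ := nnsfun_approx measurableT mf.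
transitivity (limn (fun n => \int[nu]_x (f_ n x)%:E)).
  rewrite -monotone_convergence//.
  - apply: eq_integral => y _; apply/esym/cvg_lim => //.
    by apply: cvg_nnsfun_approx=> // *; apply: f0.
  - by move=> n; exact/measurable_EFinP/measurable_funP.
  - by move=> n y _; rewrite lee_fin.
  - by move=> y _ m n mn; rewrite lee_fin; exact/lefP/nd_nnsfun_approx.
have mfg n : measurable_fun setT (fun x => (f_ n x)%:E * (g x)%:E).
  by apply: emeasurable_funM => //; exact/measurable_EFinP/measurable_funP.
rewrite [X in limn X](_ : _ = (fun n => \int[mu]_x ((f_ n x)%:E * (g x)%:E))).
  rewrite -monotone_convergence//.
  - apply: eq_integral => y _; apply/cvg_lim => //; apply: cvgeZr => //.
    by apply: cvg_nnsfun_approx => // *; apply: f0.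
  - by move=> n x _; rewrite mule_ge0// lee_fin.
  - move=> x _ m n mn; apply: lee_wpmul2r; first by rewrite lee_fin.
    by rewrite lee_fin; exact/lefP/nd_nnsfun_approx.
apply/funext => n.
have mfn r : measurable (f_ n @^-1` [set r]) by exact: measurable_sfunP.
have gE : (fun x => (f_ n x)%:E * (g x)%:E) =
    (fun x => \sum_(k \in range (f_ n))
               k%:E * ((g x)%:E * (\1_(f_ n @^-1` [set k]) x)%:E)).
  apply/funext => x; rewrite {1}fimfunE -fsumEFin// ge0_mule_fsuml//.
    by apply: eq_fsbigr => r _; rewrite EFinM -muleA [X in _ * X]muleC.
  by move=> r; exact: nnfun_muleindic_ge0.
transitivity (\sum_(k \in range (f_ n))
    \int[nu]_x (k * \1_(f_ n @^-1` [set k]) x)%:E).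
  under eq_integral do rewrite fimfunE -fsumEFin//.
  rewrite ge0_integral_fsum//.
  - by move=> y; exact/measurable_EFinP/measurable_funM.
  - by move=> y x _; rewrite nnfun_muleindic_ge0.
rewrite gE ge0_integral_fsum//; last 2 first.
  - move=> k; apply: emeasurable_funM => //; apply: emeasurable_funM => //.
    exact/measurable_EFinP.
  - move=> k x _; rewrite [X in _ * X]muleC muleA.
    apply: mule_ge0; last by rewrite lee_fin.
    exact: nnfun_muleindic_ge0.
apply: eq_fsbigr => r; rewrite inE => -[x _ <-].
have fx0 : (0 <= f_ n x)%R by [].
rewrite ge0_integralZl//; last 2 first.
  - by apply: emeasurable_funM => //; exact/measurable_EFinP.
  - by move=> y _; rewrite mule_ge0// lee_fin.
under eq_integral do rewrite EFinM.
rewrite ge0_integralZl//; last exact/measurable_EFinP.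
rewrite integral_indic// setIT nuE//.
rewrite integral_mkcond; congr (_ * _); apply: eq_integral => y _.
by rewrite epatch_indic.
Qed.

End density.

(** * Expectations from conditional laws *)

Section conditional_law.
Local Open Scope ereal_scope.
Context d (Omega : measurableType d) d1 (T : measurableType d1)
  d2 (E : measurableType d2) (R : realType).
Variables (P : probability Omega R) (eta : probability E R).
Variables (S : {RV P >-> T}) (X : {RV P >-> E}).
Variables (K : nat) (I : Omega -> 'I_K).
Variables (rho : 'I_K -> T -> R) (q : 'I_K -> T * E -> R).
Hypotheses (mI : forall k, measurable (I @^-1` [set k]))
  (mrho : forall k, measurable_fun setT (rho k))
  (rho0 : forall k z, (0 <= rho k z)%R)
  (mq : forall k, measurable_fun setT (q k))
  (q0 : forall k z, (0 <= q k z)%R).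
Hypothesis index_law : forall k A, measurable A ->
  P (S @^-1` A `&` I @^-1` [set k]) =
    \int[P]_(w in S @^-1` A) (rho k (S w))%:E.
Hypothesis sample_law : forall k A B, measurable A -> measurable B ->
  P (S @^-1` A `&` I @^-1` [set k] `&` X @^-1` B) =
    \int[P]_(w in S @^-1` A `&` I @^-1` [set k])
      \int[eta]_(x in B) (q k (S w, x))%:E.

(** Both sides integrate u against a measure on T, and these measures agree by
[index_law]: the law of S restricted to the event I = k has density rho_k with
respect to the law of S. *)
Lemma integral_index (k : 'I_K) (u : T -> \bar R) :
  measurable_fun setT u -> (forall z, 0 <= u z) ->
  \int[P]_(w in I @^-1` [set k]) u (S w) =
  \int[P]_w (u (S w) * (rho k (S w))%:E).
Proof.
move=> mu u0.
have mS : measurable_fun setT S by [].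
have muS : measurable_fun setT (u \o S) by exact: measurableT_comp.
pose Pk := mrestr P (mI k).
have -> : \int[P]_(w in I @^-1` [set k]) u (S w) = \int[Pk]_w u (S w).
  rewrite (@ge0_integral_density _ _ _ P (\1_(I @^-1` [set k])) _ _ Pk)//.
  - by rewrite [LHS]integral_mkcond; apply: eq_integral => w _; rewrite epatch_indic.
  - move=> A mA; rewrite integral_indic// /Pk /mrestr setIC//.
rewrite -[LHS](@ge0_integral_pushforward _ _ _ _ _ S mS Pk setT u)//.
rewrite (@ge0_integral_density _ _ _ (pushforward P S) (rho k))//.
  rewrite (@ge0_integral_pushforward _ _ _ _ _ S mS P setT)//.
  - apply: emeasurable_funM => //; exact/measurable_EFinP.
  - by move=> z _; rewrite mule_ge0// lee_fin.
move=> A mA.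
rewrite [LHS](_ : _ = P (S @^-1` A `&` I @^-1` [set k]))// index_law//.
rewrite [RHS](@ge0_integral_pushforward _ _ _ _ _ S mS P A (EFin \o rho k))//.
  exact/measurable_funTS/measurable_EFinP.
by move=> z _; rewrite lee_fin.
Qed.

Let D (z : T * E) : R := \sum_(k < K) rho k z.1 * q k z.

Let mD : measurable_fun setT D.
Proof.
apply: measurable_sum => k; apply: measurable_funM => //.
by apply: measurableT_comp => //.
Qed.

Let D0 z : (0 <= D z)%R.
Proof. by apply: sumr_ge0 => k _; exact: mulr_ge0. Qed.

(** Splitting over the value of I reduces the law of (S, X) on rectangles to the
hypotheses, the restriction to I = k being traded for the factor rho_k. *)
Lemma joint_law_rect (A : set T) (B : set E) :
  measurable A -> measurable B ->
  P (S @^-1` A `&` X @^-1` B) =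
  \int[P]_w \int[eta]_x ((\1_A (S w) * \1_B x)%:E * (D (S w, x))%:E).
Proof.
move=> mA mB.
have mS : measurable_fun setT S by [].
have mX : measurable_fun setT X by [].
have mSA : measurable (S @^-1` A) by rewrite -[X in measurable X]setTI; exact: mS.
have mXB : measurable (X @^-1` B) by rewrite -[X in measurable X]setTI; exact: mX.
pose Q k z := \int[eta]_x ((\1_B x)%:E * (q k (z, x))%:E).
have mQ k : measurable_fun setT (Q k).
  apply: (measurable_fun_fubini_tonelli_F (m2 := eta)
    (fun z : T * E => (\1_B z.2)%:E * (q k z)%:E)).
  - apply: emeasurable_funM => //; last exact/measurable_EFinP.
    by apply/measurable_EFinP/measurableT_comp.
  - by move=> z; rewrite mule_ge0// lee_fin.
have Q0 k z : 0 <= Q k z.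
  by apply: integral_ge0 => x _; rewrite mule_ge0// lee_fin.
have mqz k z : measurable_fun setT (fun x => (q k (z, x))%:E).
  by apply/measurable_EFinP/measurableT_comp.
have -> : S @^-1` A `&` X @^-1` B =
    \big[setU/set0]_(k < K) (S @^-1` A `&` I @^-1` [set k] `&` X @^-1` B).
  rewrite -bigcup_seq; apply/seteqP; split => [w [wA wB]|w [k _ [[wA _] wB]]//].
  by exists (I w) => //=; rewrite mem_index_enum.
rewrite measure_bigsetU_ord//; last 2 first.
- by move=> k; apply: measurableI => //; exact: measurableI.
- by apply/trivIsetP => i j _ _ ij; rewrite -subset0 => w [[[_ wi] _] [[_ wj] _]];
    move: ij; rewrite -wi -wj eqxx.
transitivity (\sum_(k < K) \int[P]_w
    ((\1_A (S w))%:E * Q k (S w) * (rho k (S w))%:E)).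
  apply: eq_bigr => k _; rewrite [LHS](sample_law k mA mB).
  rewrite setIC integral_mkcondr.
  rewrite -(@integral_index k (fun z => (\1_A z)%:E * Q k z)).
  - apply: eq_integral => w _; rewrite epatch_indic muleC; congr (_ * _).
    by rewrite integral_mkcond; apply: eq_integral => x _;
      rewrite epatch_indic muleC.
  - by apply: emeasurable_funM => //; exact/measurable_EFinP.
  - by move=> z; rewrite mule_ge0// lee_fin.
rewrite -ge0_integral_sum//; last 2 first.
- move=> k; apply: emeasurable_funM; last exact/measurable_EFinP/measurableT_comp.
  apply: emeasurable_funM; first exact/measurable_EFinP/measurableT_comp.
  exact: (measurableT_comp (mQ k)).
- by move=> k w _; rewrite !mule_ge0// lee_fin.
apply: eq_integral => w _.
under [RHS]eq_integral do rewrite EFinM -muleA.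
have mDw : measurable_fun setT (fun x => (D (S w, x))%:E).
  exact/measurable_EFinP/measurableT_comp.
rewrite ge0_integralZl//; last 2 first.
- by apply: emeasurable_funM => //; exact/measurable_EFinP.
- by move=> x _; rewrite mule_ge0// lee_fin.
under eq_bigr do rewrite -muleA.
rewrite -ge0_sume_distrr; last by move=> k _; rewrite mule_ge0// lee_fin.
congr (_ * _).
transitivity (\sum_(k < K) \int[eta]_x
    ((rho k (S w))%:E * ((\1_B x)%:E * (q k (S w, x))%:E))).
  apply: eq_bigr => k _; rewrite ge0_integralZl//; first by rewrite muleC.
  - by apply: emeasurable_funM => //; exact/measurable_EFinP.
  - by move=> x _; rewrite mule_ge0// lee_fin.
  - by rewrite lee_fin.
rewrite -ge0_integral_sum//; last 2 first.
- move=> k; apply: emeasurable_funM => //.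
  by apply: emeasurable_funM => //; exact/measurable_EFinP.
- by move=> k x _; rewrite !mule_ge0// lee_fin.
apply: eq_integral => x _; rewrite /D /= -EFinM mulr_sumr -sumEFin.
by apply: eq_bigr => k _; rewrite -!EFinM mulrCA.
Qed.

(** Given S, the variable X has the mixture density sum_k rho_k q_k.  The
hypotheses describe the law of (S, X) on rectangles only; these form a
pi-system, so the law is the product of the law of S and eta, weighted by the
mixture density. *)
Theorem expectation_conditional_law (f : T * E -> \bar R) :
  measurable_fun setT f -> (forall z, 0 <= f z) ->
  \int[P]_w f (S w, X w) =
  \int[P]_w \int[eta]_x
    (f (S w, x) * (\sum_(k < K) rho k (S w) * q k (S w, x))%:E).
Proof.
move=> mf f0.
have mS : measurable_fun setT S by [].
have mX : measurable_fun setT X by [].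
pose nu : probability T R := distribution P S.
pose phi w := (S w, X w).
have mphi : measurable_fun setT phi by exact/measurable_fun_pair.
have [m2 m2E] := density_measure_exists (nu \x eta) mD D0.
have int2 g : measurable_fun setT g -> (forall z, 0 <= g z) ->
    \int[m2]_z g z = \int[P]_w \int[eta]_x (g (S w, x) * (D (S w, x))%:E).
  move=> mg g0.
  rewrite (@ge0_integral_density _ _ _ (nu \x eta) D)//.
  have mgD : measurable_fun setT (fun z => g z * (D z)%:E).
    by apply: emeasurable_funM => //; exact/measurable_EFinP.
  have gD0 z : 0 <= g z * (D z)%:E by rewrite mule_ge0// lee_fin.
  rewrite fubini_tonelli1//.
  rewrite (@ge0_integral_pushforward _ _ _ _ _ S mS P setT)//.
    exact: measurable_fun_fubini_tonelli_F.
  by move=> z _; apply: integral_ge0.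
rewrite -[LHS](@ge0_integral_pushforward _ _ _ _ _ phi mphi P setT f)//.
rewrite -int2//; apply: eq_measure_integral => C mC _.
pose G : set (set (T * E)) :=
  [set C | exists A, measurable A /\ exists B, measurable B /\ C = A `*` B].
apply: (measure_unique G (fun=> setT)) => //.
- rewrite measurable_prod_measurableType //; congr (<<s _ >>).
  rewrite predeqE; split => [[A mA [B mB <-]]|[A [mA [B [mB ->]]]]].
    by exists A; split => //; exists B.
  by exists A => //; exists B.
- move=> /= _ _ [X1 [mX1 [X2 [mX2 ->]]]] [Y1 [mY1 [Y2 [mY2 ->]]]].
  rewrite -setXI; exists (X1 `&` Y1); split; first exact: measurableI.
  by exists (X2 `&` Y2); split => //; exact: measurableI.
- move=> _; exists setT; split => //; exists setT; split => //.
  by rewrite setXTT.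
- by rewrite bigcup_const.
- move=> _ [A [mA [B [mB ->]]]].
  rewrite [LHS](_ : _ = P (S @^-1` A `&` X @^-1` B))//.
  rewrite joint_law_rect//.
  have mAB : measurable (A `*` B) by exact: measurableX.
  have -> : m2 (A `*` B) = \int[m2]_z (\1_(A `*` B) z)%:E.
    by rewrite integral_indic// setIT.
  rewrite [RHS](int2 (fun z => (\1_(A `*` B) z)%:E))//; last exact/measurable_EFinP.
  apply: eq_integral => w _; apply: eq_integral => x _; congr (_%:E * _).
  by rewrite !indicE -natrM mulnb in_setX.
- move=> _ /=; rewrite /pushforward.
  by rewrite (le_lt_trans (probability_le1 _ _))// ?ltry// preimage_setT.
Qed.

End conditional_law.

(** * Borel structure of finite-dimensional spaces *)

Section borel_rV.
Context {R : realType}.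

Lemma continuous_measurable_rV n (f : 'rV[R]_n -> R) :
  continuous f -> measurable_fun [set: borel_rV R n] (f : borel_rV R n -> R).
Proof.
move=> /continuousP cf; apply: (measurability _ (RGenOpens.measurableE R)).
move=> _ [_ [a [b ->] <-]]; rewrite setTI.
by apply: sub_sigma_algebra; exact: cf.
Qed.

Lemma measurable_coord n (i : 'I_n) :
  measurable_fun [set: borel_rV R n] (fun v : borel_rV R n => (v : 'rV[R]_n) ord0 i).
Proof. by apply: continuous_measurable_rV; exact: coord_continuous. Qed.

(** An open set is a countable union of cubes with rational centres and radii
1/(k+1), and the preimage of a cube is a finite intersection of conditions on
the coordinates. *)
Lemma measurable_fun_borel_rV d (T : measurableType d) n (f : T -> 'rV[R]_n) :
  (forall i, measurable_fun setT (fun t => f t ord0 i)) ->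
  measurable_fun setT (f : T -> borel_rV R n).
Proof.
move=> mf; apply: (@measurability _ _ T (borel_rV R n) setT f (@open 'rV[R]_n)) => [|_ [U oU <-]]; first by []; rewrite setTI.
pose V (a : nat) : set 'rV[R]_n :=
  if (unpickle a : option ('rV[rat]_n * nat)) is Some qk then
    let b := [set v : 'rV[R]_n | forall i : 'I_n,
        `|ratr (qk.1 ord0 i) - v ord0 i| < qk.2.+1%:R^-1] in
    if `[< b `<=` U >] then b else set0
  else set0.
have -> : f @^-1` U = \bigcup_a (f @^-1` V a).
  rewrite -preimage_bigcup; congr (_ @^-1` _); apply/seteqP; split.
    move=> v Uv.
    have /nbhs_ballP[e /= e0 be] := open_nbhs_nbhs (conj oU Uv).
    have [k _ /(_ k (leqnn k)) /= ke] := near_infty_natSinv_lt (PosNum (divr_gt0 e0 (ltr0Sn _ 1))).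
    have kpos : (0 : R) < k.+1%:R^-1 by rewrite invr_gt0.
    have qE i : exists q : rat, `|ratr q - v ord0 i| < k.+1%:R^-1.
      have /rat_in_itvoo[q] : v ord0 i - k.+1%:R^-1 < v ord0 i + k.+1%:R^-1.
        by rewrite ltrD2l gtrN.
      by rewrite in_itv/= -ltr_distl => qv; exists q.
    pose q : 'rV[rat]_n := \row_i projT1 (cid (qE i)).
    exists (pickle (q, k)) => //; rewrite /V pickleK /= ifT.
      by move=> i; rewrite mxE; case: cid.
    apply/asboolP => u /= qu; apply: be; split => // i j.
    rewrite !ord1 /ball /= (splitr e).
    apply: le_lt_trans (ler_distD (ratr (q ord0 j)) _ _) _.
    apply: ltrD; last exact: lt_trans (qu j) ke.
    by apply: lt_trans ke; rewrite distrC mxE; case: cid.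
  move=> v [a _]; rewrite /V; case: unpickle => // qk.
  by case: asboolP => // + vb; apply.
apply: bigcupT_measurable => a; rewrite /V.
case: unpickle => [qk|]; last by rewrite preimage_set0.
case: ifPn => _; last by rewrite preimage_set0.
rewrite [X in measurable X](_ : _ = \bigcap_(i in [set: 'I_n])
   [set t | `|ratr (qk.1 ord0 i) - f t ord0 i| < qk.2.+1%:R^-1]); last first.
  by apply/seteqP; split => t /= h; [move=> i _; exact: h|move=> i; exact: h].
apply: fin_bigcap_measurable => // i _.
have mfi : measurable_fun setT (fun t => `|ratr (qk.1 ord0 i) - f t ord0 i|).
  by apply: measurableT_comp => //; apply: measurable_funB.
rewrite -[X in measurable X]setTI.
have /(_ measurableT) := mfi.
by move=> /(_ [set x | x < qk.2.+1%:R^-1]); apply; rewrite -set_itvNyo.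
Qed.
End borel_rV.

Section dot.
Context {R : realType}.
Implicit Types n : nat.

Lemma dotDl n (u v w : 'rV[R]_n) : dot (u + v) w = dot u w + dot v w.
Proof.
by rewrite /dot -big_split; apply: eq_bigr => i _; rewrite mxE mulrDl.
Qed.

Lemma dotNl n (u w : 'rV[R]_n) : dot (- u) w = - dot u w.
Proof.
by rewrite /dot -sumrN; apply: eq_bigr => i _; rewrite mxE mulNr.
Qed.

Lemma dotBl n (u v w : 'rV[R]_n) : dot (u - v) w = dot u w - dot v w.
Proof. by rewrite dotDl dotNl. Qed.

Lemma dotZl n (c : R) (u w : 'rV[R]_n) : dot (c *: u) w = c * dot u w.
Proof.
by rewrite /dot mulr_sumr; apply: eq_bigr => i _; rewrite mxE mulrA.
Qed.

Lemma dotC n (u w : 'rV[R]_n) : dot u w = dot w u.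
Proof. by apply: eq_bigr => i _; rewrite mulrC. Qed.

Lemma dot0l n (w : 'rV[R]_n) : dot 0 w = 0.
Proof. by rewrite /dot big1// => i _; rewrite mxE mul0r. Qed.

Lemma dot_delta n (i : 'I_n) (w : 'rV[R]_n) : dot (delta_mx ord0 i) w = w ord0 i.
Proof.
rewrite /dot (bigD1 i)//= big1 ?addr0 ?mxE ?eqxx ?mul1r// => j ji.
by rewrite mxE (negbTE ji) andbF mul0r.
Qed.

Lemma normr_coord n (i : 'I_n) (v : 'rV[R]_n) : `|v ord0 i| <= `|v|.
Proof.
rewrite [leRHS](mx_normrE v); apply/bigmax_geP; right => /=.
by exists (ord0, i).
Qed.

Lemma normr_dot n (u v : 'rV[R]_n) : `|dot u v| <= n%:R * `|u| * `|v|.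
Proof.
apply: le_trans (ler_norm_sum _ _ _) _.
have -> : n%:R * `|u| * `|v| = \sum_(i < n) `|u| * `|v|.
  by rewrite sumr_const card_ord -mulrA mulr_natl.
by apply: ler_sum => i _; rewrite normrM ler_pM// normr_coord.
Qed.

Lemma measurable_dot d (T : measurableType d) n (u v : T -> borel_rV R n) :
  measurable_fun setT u -> measurable_fun setT v ->
  measurable_fun setT (fun t => dot (u t) (v t)).
Proof.
move=> mu mv; apply: measurable_sum => i; apply: measurable_funM.
- exact: (measurableT_comp (measurable_coord i)).
- exact: (measurableT_comp (measurable_coord i)).
Qed.

Lemma measurable_norm_rV n :
  measurable_fun setT (fun v : borel_rV R n => `|v : 'rV[R]_n|).
Proof. by apply: continuous_measurable_rV => v; exact: norm_continuous. Qed.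

Lemma continuous_measurable_rVrV n p (f : 'rV[R]_n -> 'rV[R]_p) :
  continuous f -> measurable_fun setT (f : borel_rV R n -> borel_rV R p).
Proof.
move=> cf; apply: measurable_fun_borel_rV => i.
apply: (@continuous_measurable_rV _ _ (fun v => f v ord0 i)) => v.
apply: (@continuous_comp _ _ _ f (fun w : 'rV[R]_p => w ord0 i)).
  exact: cf.
exact: coord_continuous.
Qed.

(** The norm is attained at some coordinate, with one sign or the other; the term 1
covers dimension 0.  This turns exponential moments along the coordinate axes
into exponential moments of the norm. *)
Lemma expR_norm_le n (c : R) (v : 'rV[R]_n) : 0 <= c ->
  expR (c * `|v|) <= 1 +
    \sum_(i < n) (expR (c * v ord0 i) + expR (- c * v ord0 i)).
Proof.
move=> c0; have [v0|v0] := eqVneq `|v| 0.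
  rewrite v0 mulr0 expR0 lerDl; apply: sumr_ge0 => i _.
  by rewrite addr_ge0 ?expR_ge0.
have [oi vi] : exists i, `|v| = `|v i.1 i.2| by exact: mx_norm_neq0 v0.
case: oi vi => o i /=; rewrite (ord1 o) => vi; rewrite vi (bigD1 i)//= addrCA.
apply: (@le_trans _ _ (expR (c * v ord0 i) + expR (- c * v ord0 i))).
  have [vi0|vi0] := leP 0 (v ord0 i).
    by rewrite ger0_norm// lerDl expR_ge0.
  by rewrite ltr0_norm// mulrN mulNr lerDr expR_ge0.
rewrite lerDl addr_ge0//; apply: sumr_ge0 => j _.
by rewrite addr_ge0 ?expR_ge0.
Qed.

End dot.

Section borel_operations.
Context {R : realType} {d : measure_display} {T : measurableType d}.

Lemma measurable_rVD n (u v : T -> borel_rV R n) :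
  measurable_fun setT u -> measurable_fun setT v ->
  measurable_fun setT (fun t => (u t : 'rV[R]_n) + (v t : 'rV[R]_n) : borel_rV R n).
Proof.
move=> mu mv; apply: measurable_fun_borel_rV => i.
under eq_fun do rewrite mxE.
by apply: measurable_funD; apply: (measurableT_comp (measurable_coord i)).
Qed.

Lemma measurable_rVZ n (c : R) (u : T -> borel_rV R n) : measurable_fun setT u ->
  measurable_fun setT (fun t => c *: (u t : 'rV[R]_n) : borel_rV R n).
Proof.
move=> mu; apply: measurable_fun_borel_rV => i.
under eq_fun do rewrite mxE.
by apply: measurable_funM => //; apply: (measurableT_comp (measurable_coord i)).
Qed.

Lemma measurable_inv_gt0 (u : T -> R) : measurable_fun setT u ->
  (forall t, 0 < u t) -> measurable_fun setT (fun t => (u t)^-1).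
Proof.
move=> mu u0; have -> : (fun t => (u t)^-1) = (fun t => expR (- ln (u t))).
  by apply/funext => t; rewrite expRN lnK// posrE.
apply: measurableT_comp => //; apply: measurable_funN.
by apply: measurableT_comp => //; exact: measurable_ln.
Qed.

End borel_operations.

(** * The log-moment generating function and its conjugate *)

Section log_mgf.
Context {R : realType} {h m : nat}.
Variables (eta : probability (borel_rV R h) R) (G : 'rV[R]_h -> 'rV[R]_m).
Hypotheses (cG : continuous G)
  (H_fin : forall a alpha, (logmgf eta G a alpha < +oo)%E).

Local Notation intg f := (eta.-integrable setT (EFin \o f)).

Let mG : measurable_fun setT (G : borel_rV R h -> borel_rV R m).
Proof. exact: continuous_measurable_rVrV. Qed.

Definition mgf_integrand (a : 'rV[R]_h) (alpha : 'rV[R]_m) (x : borel_rV R h) : R :=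
  expR (dot a x + dot alpha (G x)).

Lemma measurable_mgf_integrand a alpha :
  measurable_fun setT (mgf_integrand a alpha).
Proof.
apply: measurableT_comp => //; apply: measurable_funD.
  by apply: (@measurable_dot R _ (borel_rV R h) h (fun=> a) id).
by apply: (@measurable_dot R _ (borel_rV R h) m (fun=> alpha) G).
Qed.

Lemma integrable_mgf_integrand a alpha : intg (mgf_integrand a alpha).
Proof.
apply/integrableP; split; first by apply/measurable_EFinP; exact: measurable_mgf_integrand.
have := H_fin a alpha; rewrite /logmgf unlock.
under [in X in _ -> X]eq_integral do rewrite /= ger0_norm ?expR_ge0//.
by case: (\int[eta]_w _)%E => // r; rewrite ltry.
Qed.

Lemma Rintegral_gt0 (f : borel_rV R h -> R) : intg f -> (forall x, 0 < f x) ->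
  0 < \int[eta]_x f x.
Proof.
move=> intf f0; rewrite lt_neqAle Rintegral_ge0 ?andbT; last by move=> x _; exact: ltW.
apply/eqP => /esym/eqP; rewrite fine_eq0; last first.
  exact: integrable_fin_num.
move=> /eqP i0.
have /ae_eq_integral_abs : measurable_fun setT (EFin \o f) by case/integrableP: intf.
move=> /(_ eta measurableT) [+ _].
have -> : (\int[eta]_x `|(EFin \o f) x| = 0)%E.
  rewrite -[RHS]i0; apply: eq_integral => x _ /=.
  by rewrite ger0_norm// ltW.
move=> /(_ erefl) [N [mN N0]] sN.
have : N = setT.
  rewrite -subTset => x _; apply: sN => /= /(_ Logic.I)/eqP.
  by rewrite eqe gt_eqF.
move=> NT; have := probability_setT eta; rewrite -NT [LHS]N0 => /eqP.
by rewrite eq_sym onee_eq0.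
Qed.

(** The real number exp(H(a, alpha)); see [logmgfE]. *)
Definition mgf a alpha : R := \int[eta]_x mgf_integrand a alpha x.

Lemma mgf_gt0 a alpha : 0 < mgf a alpha.
Proof.
apply: Rintegral_gt0; first exact: integrable_mgf_integrand.
by move=> x; exact: expR_gt0.
Qed.

Lemma expR_ln_mgf a alpha : expR (ln (mgf a alpha)) = mgf a alpha.
Proof. by rewrite lnK// posrE mgf_gt0. Qed.

Lemma logmgfE a alpha : logmgf eta G a alpha = (ln (mgf a alpha))%:E.
Proof.
rewrite /logmgf unlock -lne_EFin ?mgf_gt0//; congr lne.
rewrite /mgf /Rintegral fineK//.
by apply: integrable_fin_num => //; exact: integrable_mgf_integrand.
Qed.

(** Bounding u + v by 2 max(u, v) separates x from G(x); each norm is then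
controlled by finitely many values of the moment generating function. *)
Lemma integrable_expR_norms (c : R) : 0 <= c ->
  intg (fun x => expR (c * `|x : 'rV[R]_h| + c * `|G x|)).
Proof.
move=> c0.
have c20 : 0 <= 2 * c by rewrite mulr_ge0.
have mnG : measurable_fun setT (fun x : borel_rV R h => `|G x|).
  exact: (measurableT_comp (@measurable_norm_rV _ _)).
have mn : measurable_fun setT (fun x : borel_rV R h => `|x : 'rV[R]_h|).
  exact: measurable_norm_rV.
pose B1 (x : borel_rV R h) : R := 1 +
    \sum_(i < h) (expR (2 * c * (x : 'rV[R]_h) ord0 i) +
                  expR (- (2 * c) * (x : 'rV[R]_h) ord0 i)).
pose B2 (x : borel_rV R h) : R := 1 +
    \sum_(i < m) (expR (2 * c * G x ord0 i) + expR (- (2 * c) * G x ord0 i)).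
apply: (@integrable_le _ _ _ _ _ (B1 \+ B2)).
- by apply: measurableT_comp => //; apply: measurable_funD; apply: measurable_funM.
- move=> x; rewrite expR_ge0 /=.
  have [xG|Gx] := leP `|x : 'rV[R]_h| `|G x|.
    apply: (@le_trans _ _ (expR (2 * c * `|G x|))).
      by rewrite ler_expR; have := ler_wpM2l c0 xG; lra.
    apply: le_trans (expR_norm_le _ c20) _; rewrite lerDr.
    by rewrite addr_ge0//; apply: sumr_ge0 => i _; rewrite addr_ge0 ?expR_ge0.
  apply: (@le_trans _ _ (expR (2 * c * `|x : 'rV[R]_h|))).
    by rewrite ler_expR; have := ler_wpM2l c0 (ltW Gx); lra.
  apply: le_trans (expR_norm_le _ c20) _; rewrite lerDl.
  by rewrite addr_ge0//; apply: sumr_ge0 => i _; rewrite addr_ge0 ?expR_ge0.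
have i1 : intg (cst 1) by apply: finite_measure_integrable_cst.
have ix k (i : 'I_h) : intg (fun x => expR (k * (x : 'rV[R]_h) ord0 i)).
  have := integrable_mgf_integrand (k *: delta_mx ord0 i) 0.
  apply: eq_integrable => // x _ /=; rewrite /mgf_integrand.
  by rewrite dot0l addr0 dotZl dot_delta.
have iG k (i : 'I_m) : intg (fun x => expR (k * G x ord0 i)).
  have := integrable_mgf_integrand 0 (k *: delta_mx ord0 i).
  apply: eq_integrable => // x _ /=; rewrite /mgf_integrand.
  by rewrite dot0l add0r dotZl dot_delta.
by apply: (integrable_add (f := B1)); apply: (integrable_add (f := cst 1)) => //;
  apply: integrable_bigsum => i; exact: integrable_add.
Qed.

Lemma normr_mgf_exponent_le a alpha : exists2 c, 0 <= c & forall x : 'rV[R]_h,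
  dot a x + dot alpha (G x) <= c * `|x| + c * `|G x|.
Proof.
exists (h%:R * `|a| + m%:R * `|alpha|); first by rewrite addr_ge0 ?mulr_ge0.
move=> x.
have := normr_dot a x; have := normr_dot alpha (G x).
move=> /ler_normlW h1 /ler_normlW h2; apply: le_trans (lerD h2 h1) _.
rewrite !mulrDl addrAC -!addrA lerD2l addrC -[leLHS]addr0.
by rewrite -addrA lerD2l addr_ge0 ?mulr_ge0.
Qed.

Lemma integrable_coord_mgf (V : borel_rV R h -> R) a alpha :
  measurable_fun setT V -> (forall x, `|V x| <= `|x : 'rV[R]_h| + `|G x|) ->
  intg (fun x => V x * mgf_integrand a alpha x).
Proof.
move=> mV Vle; have [c c0 cle] := normr_mgf_exponent_le a alpha.
have c10 : 0 <= c + 1 by rewrite addr_ge0.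
apply: le_integrable (integrable_expR_norms c10) => //.
  by apply/measurable_EFinP/measurable_funM => //; exact: measurable_mgf_integrand.
move=> x _ /=; rewrite lee_fin normrM !(ger0_norm (expR_ge0 _)).
rewrite !mulrDl !mul1r addrACA [X in _ <= expR X]addrC [leRHS]expRD.
apply: ler_pM => //; last by rewrite ler_expR.
apply: le_trans (Vle x) _.
by apply: le_trans (expR_ge1Dx _); rewrite lerDr.
Qed.

Lemma Rintegral_dot n (u : 'rV[R]_n) (V : borel_rV R h -> 'rV[R]_n)
    (w : borel_rV R h -> R) :
  (forall i, intg (fun x => V x ord0 i * w x)) ->
  \int[eta]_x (dot u (V x) * w x) =
    dot u (\row_i \int[eta]_x (V x ord0 i * w x)) /\
  intg (fun x => dot u (V x) * w x).
Proof.
move=> iV.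
have E x : dot u (V x) * w x = \sum_(i < n) u ord0 i * (V x ord0 i * w x).
  by rewrite mulr_suml; apply: eq_bigr => i _; rewrite mulrA.
have iuV i : intg (fun x => u ord0 i * (V x ord0 i * w x)).
  exact: integrable_scale.
split.
  under eq_Rintegral do rewrite E.
  rewrite Rintegral_sum//; apply: eq_bigr => i _.
  by rewrite RintegralZl// mxE.
under [fun x => _]eq_fun do rewrite E.
exact: integrable_bigsum.
Qed.

(** The subgradient is (b, beta) = the mean of (x, G(x)) under the probability
proportional to w = exp(<a, x> + <alpha, G(x)>).  Jensen's inequality under that
probability, in the form e^g >= e^kappa (1 + g - kappa) with kappa the mean of g,
gives the inequality after multiplication by w and integration. *)
Lemma logmgf_subgradient a alpha : exists b beta, forall a' alpha',
  ln (mgf a alpha) + (dot (a' - a) b + dot (alpha' - alpha) beta) <=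
  ln (mgf a' alpha').
Proof.
set w := mgf_integrand a alpha; set Z := mgf a alpha.
have Z0 : 0 < Z by exact: mgf_gt0.
have ix i : intg (fun x => (x : 'rV[R]_h) ord0 i * w x).
  apply: (@integrable_coord_mgf (fun x => (x : 'rV[R]_h) ord0 i)).
    exact: measurable_coord.
  by move=> x; apply: le_trans (normr_coord _ _) _; rewrite lerDl.
have iG i : intg (fun x => G x ord0 i * w x).
  apply: (@integrable_coord_mgf (fun x => G x ord0 i)).
    exact: (measurableT_comp (measurable_coord i)).
  by move=> x; apply: le_trans (normr_coord _ _) _; rewrite lerDr.
exists (Z^-1 *: \row_i \int[eta]_x ((x : 'rV[R]_h) ord0 i * w x)).
exists (Z^-1 *: \row_i \int[eta]_x (G x ord0 i * w x)).
move=> a' alpha'.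
have [Ex ixx] := Rintegral_dot (a' - a) ix.
have [EG iGG] := Rintegral_dot (alpha' - alpha) iG.
rewrite ![dot _ (_ *: _)]dotC !dotZl ![dot (\row_i _) _]dotC -Ex -EG -mulrDr.
have iw : intg w by exact: integrable_mgf_integrand.
rewrite -RintegralD//.
set g := fun x : borel_rV R h => dot (a' - a) x * w x + dot (alpha' - alpha) (G x) * w x.
have ig : intg g by exact: integrable_add.
set kappa := Z^-1 * _.
have gE : \int[eta]_x g x = kappa * Z.
  by rewrite /kappa mulrAC mulVf ?gt_eqF// mul1r.
clearbody kappa.
rewrite -ler_expR expRD !expR_ln_mgf -/Z.
(* The tangent-line lower bound of exp(<a', x> + <alpha', G(x)>). *)
pose lo x := expR kappa * ((1 - kappa) * w x + g x).
have iwg : intg (fun x => (1 - kappa) * w x + g x).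
  by apply: integrable_add => //; exact: integrable_scale.
have ilo : intg lo by exact: integrable_scale.
apply: (@le_trans _ _ (\int[eta]_x lo x)).
  rewrite RintegralZl// RintegralD//; last exact: integrable_scale.
  rewrite RintegralZl// -/(mgf a alpha) -/Z gE.
  rewrite [leRHS](_ : _ = Z * expR kappa)//; ring.
apply: le_Rintegral => //; first exact: integrable_mgf_integrand.
move=> x _; rewrite /lo.
have -> : mgf_integrand a' alpha' x =
    w x * (expR kappa * expR (dot (a' - a) x + dot (alpha' - alpha) (G x) - kappa)).
  by rewrite /w /mgf_integrand -!expRD !dotBl; congr expR; ring.
rewrite [leRHS]mulrCA ler_wpM2l ?expR_ge0//.
have -> : (1 - kappa) * w x + g x =
    w x * (1 + (dot (a' - a) x + dot (alpha' - alpha) (G x) - kappa)).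
  by rewrite /g mulrDr mulrDr mulr1; ring.
by rewrite ler_wpM2l ?expR_ge0// expR_ge1Dx.
Qed.

(** Fenchel duality *)
(** At a subgradient, Young's inequality between H and its conjugate is an equality. *)
Lemma legendre_attained a alpha : exists b beta,
  (legendre eta G b beta <= (dot a b + dot alpha beta - ln (mgf a alpha))%:E)%E.
Proof.
have [b [beta sub]] := logmgf_subgradient a alpha.
exists b, beta; apply: ge_ereal_sup => _ [[a' alpha'] _ <-] /=.
rewrite logmgfE -EFinB lee_fin.
by have := sub a' alpha'; rewrite !dotBl; exact: subgradient_arith.
Qed.

(** Test the infimum at a subgradient of H at (- a, - s). *)
Lemma hamiltonian_inf_le s a :
  (ereal_inf [set hamiltonian eta G s a q.1 q.2
             | q in [set: 'rV[R]_h * 'rV[R]_m]] <=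
   (- ln (mgf (- a) (- s)) - ln (mgf a 0))%:E)%E.
Proof.
have [b [beta L]] := legendre_attained (- a) (- s).
apply: ereal_inf_le; exists (hamiltonian eta G s a b beta); first by exists (b, beta).
rewrite /hamiltonian /logmgf1 logmgfE.
apply: (@le_trans _ _ ((dot a b)%:E + (dot s beta)%:E +
  (dot (- a) b + dot (- s) beta - ln (mgf (- a) (- s)))%:E - (ln (mgf a 0))%:E)%E).
  by rewrite leeB// leeD.
rewrite -!EFinD lee_fin !dotNl.
exact: fenchel_arith.
Qed.

End log_mgf.

(** * Mean values and uniform continuity on the strip *)

Section strip_analysis.
Context {R : realType} {m : nat}.
Local Notation strip := (@strip R m).

Lemma strip_continuousP (V : normedModType R) (f : 'rV[R]_m * R -> V) :
  {within strip, continuous f} -> forall p, strip p -> forall e, 0 < e ->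
  exists2 d, 0 < d & forall q, strip q ->
    `|p.1 - q.1| < d -> `|p.2 - q.2| < d -> `|f p - f q| < e.
Proof.
move=> /subspace_continuousP + p sp e e0 => /(_ p sp) /cvgrPdist_lt /(_ e e0).
move=> /nbhs_ballP[d /= d0 bd]; exists d => // q sq h1 h2.
apply: (bd q) => //; split => /=; rewrite -ball_normE//.
Qed.

Lemma strip_slice_continuous (V : normedModType R) (f : 'rV[R]_m * R -> V) t :
  0 <= t <= 1 -> {within strip, continuous f} -> continuous (fun y => f (y, t)).
Proof.
move=> t01 cf y.
have fy : Filter (nbhs (y : 'rV[R]_m)) by exact: nbhs_filter.
apply/(cvgrPdist_lt (F := nbhs y)) => e e0.
have st z : strip (z, t) by split => //=; rewrite in_itv.
have [d d0 hd] := strip_continuousP cf (st y) e0.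
apply/nbhs_ballP; exists d => // z; rewrite -ball_normE /= => yz.
by apply: hd => //=; rewrite subrr normr0.
Qed.

Definition slab (r : R) : set ('rV[R]_m * R) := [set y | `|y| <= r] `*` `[0, 1].

Lemma slab_compact r : compact (slab r).
Proof.
apply: compact_setX; last exact: segment_compact.
apply: bounded_closed_compact.
  exists r; split; first exact: num_real.
  by move=> M rM y /= yr; exact: le_trans (ltW rM).
have : closed ((fun y : 'rV[R]_m => `|y|) @^-1` [set x | x <= r]).
  by apply: closed_comp; [move=> y _; exact: norm_continuous|exact: closed_le].
by [].
Qed.

(** Heine's theorem on the compact slab: the radius is halved so that a point
close to p stays in the neighbourhood of the centre that was used for p. *)
Lemma slab_uniform_continuous (V : normedModType R) (f : 'rV[R]_m * R -> V) r e :
  {within strip, continuous f} -> 0 < e ->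
  exists2 d, 0 < d & forall p q, slab r p -> slab r q ->
    `|p.1 - q.1| < d -> `|p.2 - q.2| < d -> `|f p - f q| < e.
Proof.
move=> cf e0.
have sub p : slab r p -> strip p by move=> [_ ?]; split.
have /compact_near_coveringP/near_covering_withinP := @slab_compact r.
pose Q (d : R) p := forall q, slab r q ->
    `|p.1 - q.1| < d -> `|p.2 - q.2| < d -> `|f p - f q| < e.
move=> /(_ R (0^'+)%R Q _) [].
  move=> x sx.
  have e20 : 0 < e / 2 by rewrite divr_gt0.
  have [d d0 hd] := strip_continuousP cf (sub _ sx) e20.
  have d20 : 0 < d / 2 by rewrite divr_gt0.
  exists (ball x (d / 2), [set d' | d' < d / 2]).
    by split => /=; [exact: nbhsx_ballx|exact: nbhs_right_lt].
  move=> [p d'] /= [[]]; rewrite -!ball_normE /= => xp1 xp2 d'd sp q sq pq1 pq2.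
  rewrite -(subrK (f x) (f p)) -addrA (le_lt_trans (ler_normD _ _))// (splitr e).
  apply: ltrD.
    rewrite distrC; apply: hd; first exact: sub.
      by rewrite (lt_le_trans xp1)//; lra.
    by rewrite (lt_le_trans xp2)//; lra.
  apply: hd; first exact: sub.
    by rewrite (le_lt_trans (ler_distD p.1 _ _))//; lra.
  by rewrite (le_lt_trans (ler_distD p.2 _ _))//; lra.
move=> d /= d0 hd; exists (d / 2); first by rewrite divr_gt0.
move=> p q sp sq h1 h2.
apply: (hd (d / 2)) => //=.
  by rewrite sub0r normrN gtr0_norm ?divr_gt0//; lra.
by rewrite divr_gt0.
Qed.

End strip_analysis.

Section mean_value.
Context {R : realType} {m : nat}.
Local Notation strip := (@strip R m).
Variable W : 'rV[R]_m * R -> R.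
Hypothesis C1 : C1_strip W.

(** Mean value theorem along the segment; differentiability turns the directional
derivative into the scalar product with the gradient. *)
Lemma mean_value_space t y g d : 0 <= t <= 1 -> 0 <= d ->
  exists2 c, 0 <= c <= d &
    W (y + d *: g, t) - W (y, t) = d * dot (Dy W (y + c *: g, t)) g.
Proof.
move=> t01 d0; have [cW dW _ _ _] := C1.
have st z : strip (z, t) by split => //=; rewrite in_itv.
pose f z := W (z, t).
pose phi u : R := f (y + u *: g).
have df z : differentiable f z by exact: (dW (z, t)).
have dE z : 'd f z g = dot (Dy W (z, t)) g.
  rewrite {1}(row_sum_delta g) linear_sum /=.
  apply: eq_bigr => i _; rewrite linearZ /= mulrC; congr (_ * _).
  by rewrite mxE -deriveE.
have phiE u : (fun h : R => h^-1 *: ((phi \o shift u) (h *: 1) - phi u)) =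
    (fun h : R => h^-1 *: ((f \o shift (y + u *: g)) (h *: g) - f (y + u *: g))).
  apply/funext => h; rewrite /phi /= /shift; congr (_ *: (f _ - _)).
  by rewrite -[h *: 1]/(h * 1) mulr1 scalerDl addrCA.
have dphi u : is_derive u (1 : R) phi (dot (Dy W (y + u *: g, t)) g).
  have dfg : derivable f (y + u *: g) g by exact: diff_derivable.
  split; first by rewrite /derivable phiE.
  by rewrite /derive phiE -/(derive f (y + u *: g) g) deriveE// dE.
have [|c cd E] := @MVT_segment R phi _ 0 d d0 (fun u _ => dphi u).
  by apply: continuous_subspaceT => u; apply: differentiable_continuous;
    apply/derivable1_diffP; case: (dphi u).
exists c; first by move: cd; rewrite in_itv.
by move: E; rewrite /phi scale0r addr0 subr0 mulrC.
Qed.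

(** The mean value theorem only needs derivatives at interior times, where the
quotients within [0, 1] are the usual two-sided ones. *)
Lemma mean_value_time y t d : 0 <= t -> 0 <= d -> t + d <= 1 ->
  exists2 c, t <= c <= t + d &
    W (y, t + d) - W (y, t) = d * Dt W (y, c).
Proof.
move=> t0 d0 td; have [cW _ dtW _ _] := C1.
have st u : 0 <= u <= 1 -> strip (y, u) by move=> u01; split => //=; rewrite in_itv.
pose psi u := W (y, u).
have dpsi u : u \in `]t, (t + d)[%R -> is_derive u (1 : R) psi (Dt W (y, u)).
  rewrite in_itv /= => /andP[tu utd].
  have u01 : 0 < u < 1 by apply/andP; split; lra.
  have : diff_quotient01 psi u --> Dt W (y, u).
    by apply: (dtW (y, u)); apply: st; lra.
  move=> cq.
  have cder : (fun h : R => h^-1 *: ((psi \o shift u) (h *: 1) - psi u)) @ 0^'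
      --> Dt W (y, u).
    apply/cvgrPdist_lt => e e0.
    move: cq => /cvgrPdist_lt /(_ e e0).
    rewrite /dnbhs /within /= => /nbhs_ballP[dd /= dd0 bd].
    (* Within this radius, s + u stays in [0, 1]. *)
    pose r := Num.min dd (Num.min u (1 - u)).
    have r0 : 0 < r by rewrite !lt_min dd0; apply/and3P; split; lra.
    apply/nbhs_ballP; exists r => //= s; rewrite -ball_normE /= sub0r normrN.
    rewrite !lt_min => /and3P[sd su s1] sn0.
    have us : ball u dd (s + u).
      by rewrite -ball_normE /= opprD addrCA subrr addr0 normrN.
    have := bd _ us; rewrite -subr_eq0 !addrK => /(_ sn0).
    rewrite in_itv /= => bd'.
    rewrite -[s *: 1]/(s * 1) mulr1 /shift [_^-1 *: _]mulrC.
    apply: bd'.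
    move: su s1 => /ltr_normlP[? ?] /ltr_normlP[? ?].
    by apply/andP; split; lra.
  split; first by apply/cvg_ex; exists (Dt W (y, u)).
  by apply/cvg_lim.
have ltd : t <= t + d by rewrite lerDl.
have [|c ctd E] := @MVT_segment R psi _ t (t + d) ltd dpsi.
  apply/subspace_continuousP => u; rewrite /= in_itv /= => /andP[tu utd].
  apply/cvgrPdist_lt => e e0.
  have su : strip (y, u) by apply: st; apply/andP; split; lra.
  have [dd dd0 hd] := strip_continuousP cW su e0.
  apply/nbhs_ballP; exists dd => //= v; rewrite -ball_normE /= => uv.
  rewrite /= in_itv /= => /andP[tv vtd].
  apply: hd => //=; last by rewrite subrr normr0.
  by apply: st; apply/andP; split; lra.
exists c; first by move: ctd; rewrite in_itv.
by move: E; rewrite /psi => ->; rewrite [t + d - t]addrAC subrr add0r mulrC.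
Qed.

(** Moving first in time, then in space, avoids assuming joint differentiability. *)
Lemma mean_value_strip y g t d : 0 <= t -> 0 < d -> t + d <= 1 ->
  exists c1 c2, [/\ 0 <= c1 <= d, t <= c2 <= t + d &
    W (y + d *: g, t + d) - W (y, t) =
      d * (dot (Dy W (y + c1 *: g, t + d)) g + Dt W (y, c2))].
Proof.
move=> t0 d0 td.
have td01 : 0 <= t + d <= 1 by rewrite td andbT addr_ge0// ltW.
have [c1 c1d E1] := mean_value_space y g td01 (ltW d0).
have [c2 c2d E2] := mean_value_time y t0 (ltW d0) td.
exists c1, c2; split => //.
by rewrite mulrDr -E1 -E2 addrA subrK.
Qed.

End mean_value.

(** * One step of the scheme *)

Section one_step.
Context {R : realType} {h m : nat}.
Variables (eta : probability (borel_rV R h) R) (G : 'rV[R]_h -> 'rV[R]_m).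
Hypotheses (cG : continuous G)
  (H_fin : forall a alpha, (logmgf eta G a alpha < +oo)%E).
Variables (K : nat) (W : 'rV[R]_m * R -> R)
  (rho : 'I_K -> 'rV[R]_m * R -> R) (abar : 'I_K -> 'rV[R]_m * R -> 'rV[R]_h)
  (r : 'I_K -> 'rV[R]_m * R -> R) (s : 'I_K -> 'rV[R]_m * R -> 'rV[R]_m)
  (M : R).
Local Notation strip := (@strip R m).
Local Notation mgf := (mgf eta G).
Local Notation intg f := (eta.-integrable setT (EFin \o f)).
Hypotheses (rho0 : forall k p, strip p -> 0 <= rho k p)
  (rho1 : forall p, strip p -> \sum_k rho k p = 1)
  (C1 : C1_strip W)
  (DtE : forall p, strip p -> Dt W p = \sum_k rho k p * r k p)
  (DyE : forall p, strip p -> Dy W p = \sum_k rho k p *: s k p)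
  (isaacs : forall k p, strip p ->
    ln (mgf (- abar k p) (- s k p)) + ln (mgf (abar k p) 0) <= r k p)
  (M0 : 0 <= M)
  (bnd : forall k p, strip p ->
    [/\ `|r k p| <= M, `|s k p| <= M & `|abar k p| <= M]).

Definition mixture_density (p : 'rV[R]_m * R) (x : 'rV[R]_h) : R :=
  \sum_k rho k p * tilt_density eta G (abar k p) x.

Lemma tilt_densityE a x :
  tilt_density eta G a x = expR (dot a x - ln (mgf a 0)).
Proof. by rewrite /tilt_density /logmgf1 (logmgfE cG H_fin). Qed.

Lemma mixture_densityE p x : mixture_density p x =
  \sum_k rho k p * expR (dot (abar k p) x - ln (mgf (abar k p) 0)).
Proof. by apply: eq_bigr => k _; rewrite tilt_densityE. Qed.

Lemma mixture_density_gt0 p x : strip p -> 0 < mixture_density p x.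
Proof.
move=> sp; rewrite mixture_densityE; apply: mixture_gt0; last exact: rho1.
by move=> k; exact: rho0.
Qed.

Lemma normr_Dt_le p : strip p -> `|Dt W p| <= M.
Proof.
move=> sp; rewrite DtE//; apply: le_trans (ler_norm_sum _ _ _) _.
rewrite -[leRHS]mul1r -(rho1 sp) mulr_suml; apply: ler_sum => k _.
rewrite normrM (ger0_norm (rho0 k sp)) ler_wpM2l ?rho0//.
by have [] := bnd k sp.
Qed.

Lemma normr_Dy_le p : strip p -> `|Dy W p| <= M.
Proof.
move=> sp; rewrite DyE//; apply: le_trans (ler_norm_sum _ _ _) _.
rewrite -[leRHS]mul1r -(rho1 sp) mulr_suml; apply: ler_sum => k _.
rewrite normrZ (ger0_norm (rho0 k sp)) ler_wpM2l ?rho0//.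
by have [] := bnd k sp.
Qed.

Section step.
Variables (n : nat) (y : 'rV[R]_m) (t : R).

Definition increment (g : 'rV[R]_m) : R :=
  n%:R * (W (y + n%:R^-1 *: g, t + n%:R^-1) - W (y, t)).

(** The ratio exp(- n W) after and before the step, times the one factor l^-1 that
is left of l^-2 once the sampling density has been integrated out. *)
Definition step_weight (x : borel_rV R h) : R :=
  expR (- increment (G x)) * (mixture_density (y, t) x)^-1.

Hypotheses (n0 : (0 < n)%N) (t0 : 0 <= t) (tn : t + n%:R^-1 <= 1).

Let n0R : (0 : R) < n%:R^-1. Proof. by rewrite invr_gt0 ltr0n. Qed.

Let st u z : 0 <= u <= 1 -> strip (z, u).
Proof. by move=> u01; split => //=; rewrite in_itv. Qed.

Let syt : strip (y, t).
Proof. by apply: st; rewrite t0 (le_trans _ tn)// lerDl ltW. Qed.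

Let tn01 : 0 <= t + n%:R^-1 <= 1. Proof. by rewrite tn addr_ge0// ltW. Qed.

Lemma increment_mean_value g : exists c1 c2,
  [/\ 0 <= c1 <= n%:R^-1, t <= c2 <= t + n%:R^-1 &
   increment g = dot (Dy W (y + c1 *: g, t + n%:R^-1)) g + Dt W (y, c2)].
Proof.
have [c1 [c2 [c1n c2n E]]] := mean_value_strip C1 y g t0 n0R tn.
exists c1, c2; split => //.
by rewrite /increment E mulrA divff ?mul1r// pnatr_eq0 -lt0n.
Qed.

Lemma increment_ge g : - increment g <= m%:R * M * `|g| + M.
Proof.
have [c1 [c2 [_ /andP[c2t c2n] ->]]] := increment_mean_value g.
rewrite opprD; apply: lerD; apply: le_trans (ler_norm _) _; rewrite normrN.
  apply: le_trans (normr_dot _ _) _.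
  by rewrite ler_wpM2r// ler_wpM2l// normr_Dy_le//; exact: st.
by apply/normr_Dt_le/st; rewrite (le_trans t0)// (le_trans c2n).
Qed.

Lemma measurable_mixture_density p : measurable_fun setT (mixture_density p : borel_rV R h -> R).
Proof.
rewrite /mixture_density; apply: measurable_sum => k; apply: measurable_funM => //.
apply: measurableT_comp => //; apply: measurable_funB => //.
by apply: (@measurable_dot R _ (borel_rV R h) h (fun=> abar k p) id).
Qed.

Lemma measurable_step_weight : measurable_fun setT step_weight.
Proof.
have cW : continuous (fun g : 'rV[R]_m => W (y + n%:R^-1 *: g, t + n%:R^-1)).
  have [cW _ _ _ _] := C1.
  have := strip_slice_continuous tn01 cW => cWt g.
  apply: (@continuous_comp _ _ _ (fun g : 'rV[R]_m => y + n%:R^-1 *: g) (fun z => W (z, t + n%:R^-1))).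
    by apply: continuousD; [exact: cst_continuous|exact: scaler_continuous].
  exact: cWt.
apply: measurable_funM.
  apply: measurableT_comp => //; apply: measurable_funN.
  apply: measurable_funM => //; apply: measurable_funB => //.
  apply: (measurableT_comp (continuous_measurable_rV cW)).
  exact: continuous_measurable_rVrV.
apply: measurable_inv_gt0; first exact: measurable_mixture_density.
by move=> x; exact: mixture_density_gt0.
Qed.

Lemma step_weight_ge0 x : 0 <= step_weight x.
Proof. by rewrite mulr_ge0 ?expR_ge0// invr_ge0 ltW// mixture_density_gt0. Qed.

(** The mixture is bounded below by Jensen's inequality, hence its inverse is at
most a mixture of exp(- <a_k, x> + H_1(a_k)). *)
Lemma step_weight_le (Hmax : R) x :
  (forall a, `|a| <= M -> ln (mgf a 0) <= Hmax) ->
  step_weight x <=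
    expR (m%:R * M * `|G x| + M) * expR (h%:R * M * `|x : 'rV[R]_h| + Hmax).
Proof.
move=> Hle; apply: ler_pM; rewrite ?expR_ge0//.
- by rewrite invr_ge0 ltW// mixture_density_gt0.
- by rewrite ler_expR increment_ge.
rewrite mixture_densityE -[leLHS]mul1r -[X in X * _]expR0.
have rho0' k : 0 <= rho k (y, t) by exact: rho0.
have := expR_div_mixture (fun=> 0)
  (fun k => dot (abar k (y, t)) x - ln (mgf (abar k (y, t)) 0)) rho0' (rho1 syt).
under eq_bigr do rewrite mulr0.
rewrite big1// oppr0 => /le_trans; apply.
have -> : expR (h%:R * M * `|x : 'rV[R]_h| + Hmax) =
    \sum_k rho k (y, t) * expR (h%:R * M * `|x : 'rV[R]_h| + Hmax).
  by rewrite -mulr_suml rho1// mul1r.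
apply: ler_sum => k _; rewrite ler_wpM2l// ler_expR sub0r opprB addrC.
have [_ _ ak] := bnd k syt.
apply: lerD; last exact: Hle.
apply: le_trans (ler_norm _) _; rewrite normrN.
apply: le_trans (normr_dot _ _) _.
by rewrite ler_wpM2r// ler_wpM2l.
Qed.

End step.

Lemma ln_mgf_bounded : exists Hmax, forall a, `|a| <= M -> ln (mgf a 0) <= Hmax.
Proof.
have c0 : 0 <= h%:R * M by rewrite mulr_ge0.
have iB := integrable_expR_norms cG H_fin c0.
exists (ln (\int[eta]_x expR (h%:R * M * `|x : 'rV[R]_h| + h%:R * M * `|G x|))).
move=> a aM.
have le_mgf : mgf a 0 <=
    \int[eta]_x expR (h%:R * M * `|x : 'rV[R]_h| + h%:R * M * `|G x|).
  apply: le_Rintegral => //; first exact: integrable_mgf_integrand.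
  move=> x _; rewrite /mgf_integrand dot0l addr0 ler_expR.
  rewrite -[leLHS]addr0; apply: lerD; last by rewrite mulr_ge0.
  apply: le_trans (ler_norm _) _; apply: le_trans (normr_dot _ _) _.
  by rewrite ler_wpM2r// ler_wpM2l.
have gt0 := mgf_gt0 cG H_fin a 0.
by rewrite ler_ln ?posrE//; exact: lt_le_trans le_mgf.
Qed.

(** The factor e^|G(x)| leaves room to absorb the growth of |y| over one step and
to make the contribution of large G(x) small. *)
Lemma step_weight_envelope : exists E : borel_rV R h -> R,
  [/\ intg E, forall x, 0 <= E x &
    forall n y t x, (0 < n)%N -> 0 <= t -> t + n%:R^-1 <= 1 ->
    step_weight n y t x * expR `|G x| <= E x].
Proof.
have [Hmax Hle] := ln_mgf_bounded.
(* h M bounds the slope in x of the tilts, m M the slope in G(x) of the increment,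
   and 1 is for the factor e^|G(x)|. *)
pose c := (h%:R + m%:R) * M + 1.
have c0 : 0 <= c by rewrite addr_ge0// mulr_ge0// addr_ge0.
exists (fun x => expR (M + Hmax) * expR (c * `|x : 'rV[R]_h| + c * `|G x|)); split.
- exact/integrable_scale/integrable_expR_norms.
- by move=> x; rewrite mulr_ge0 ?expR_ge0.
move=> n y t x n0 t0 tn.
apply: (@le_trans _ _ (expR (m%:R * M * `|G x| + M) *
    expR (h%:R * M * `|x : 'rV[R]_h| + Hmax) * expR `|G x|)).
  by rewrite ler_wpM2r ?expR_ge0// step_weight_le.
rewrite -!expRD ler_expR /c !mulrDl !mul1r.
have := mulr_ge0 (mulr_ge0 (ler0n R h) M0) (normr_ge0 (G x)).
have := mulr_ge0 (mulr_ge0 (ler0n R m) M0) (normr_ge0 (x : 'rV[R]_h)).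
have := normr_ge0 (x : 'rV[R]_h).
move: (h%:R * M * `|G x|) (m%:R * M * `|x : 'rV[R]_h|) (h%:R * M * `|x : 'rV[R]_h|)
  (m%:R * M * `|G x|) `|x : 'rV[R]_h| `|G x| => u1 u2 u3 u4 u5 u6.
exact: envelope_arith.
Qed.

(** The derivatives in the mean value formula are taken at distance O((N + 1) / n)
of (y, t), inside a fixed slab on which Dy and Dt are uniformly continuous. *)
Lemma increment_near (b N d : R) : 0 <= N -> 0 < d ->
  \forall n \near \oo, forall y t g, 0 <= t -> t + n%:R^-1 <= 1 ->
    `|y| <= b -> `|g| <= N ->
    dot (Dy W (y, t)) g + Dt W (y, t) - d <= increment n y t g.
Proof.
move=> N0 d0; have [_ _ _ cDy cDt] := C1.
pose e1 := d / (2 * (m%:R * N + 1)).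
have mN0 : 0 < m%:R * N + 1 by rewrite ltr_wpDl ?mulr_ge0.
have e10 : 0 < e1 by rewrite divr_gt0// mulr_gt0.
have d20 : 0 < d / 2 by rewrite divr_gt0.
have [d1 d10 hDy] := @slab_uniform_continuous _ _ _ _ (b + N) _ cDy e10.
have [d2 d20' hDt] := @slab_uniform_continuous _ _ _ _ (b + N) _ cDt d20.
pose d3 := Num.min 1 (Num.min (d1 / (N + 1)) (d2 / (N + 1))).
have N10 : 0 < N + 1 by rewrite ltr_wpDl.
have d30 : 0 < d3 by rewrite !lt_min ltr01 !divr_gt0.
have [k _ hk] := near_infty_natSinv_lt (PosNum d30).
exists k.+1 => // -[//|n] /= kn y t g t0 tn yb gN.
have {}hk : n.+1%:R^-1 < d3 by exact: hk.
have n0R : (0 : R) < n.+1%:R^-1 by rewrite invr_gt0.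
have [c1 [c2 [/andP[c10 c1n] /andP[c2t c2n] ->]]] := increment_mean_value y (isT : (0 < n.+1)%N) t0 tn g.
move: hk; rewrite !lt_min => /and3P[n1 nd1 nd2].
have {}nd1 : n.+1%:R^-1 * (N + 1) < d1 by rewrite -ltr_pdivlMr.
have {}nd2 : n.+1%:R^-1 * (N + 1) < d2 by rewrite -ltr_pdivlMr.
set i := n.+1%:R^-1 in n0R tn c1n c2n n1 nd1 nd2 *.
have t1 : t <= 1 by apply: le_trans tn; rewrite lerDl ltW.
have cg : `|c1 *: g| <= i * N by rewrite normrZ (ger0_norm c10) ler_pM.
have iN : i * N <= N by rewrite ler_piMl// ltW.
have iN1 : i * (N + 1) = i * N + i by rewrite mulrDr mulr1.
have ile : i <= i * (N + 1) by rewrite ler_peMr ?lerDr// ltW.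
have syt : slab (b + N) (y, t).
  by split => /=; [rewrite (le_trans yb)// lerDl|rewrite in_itv /= t0].
have s1 : slab (b + N) (y + c1 *: g, t + i).
  split => /=; last by rewrite in_itv /= tn addr_ge0// ltW.
  by apply: le_trans (ler_normD _ _) _; rewrite lerD// (le_trans cg).
have s2 : slab (b + N) (y, c2).
  split => /=; first by rewrite (le_trans yb)// lerDl.
  by rewrite in_itv /= (le_trans t0)//= (le_trans c2n).
have h1 : `|Dy W (y, t) - Dy W (y + c1 *: g, t + i)| < e1.
  apply: hDy => //=.
    rewrite opprD addNKr normrN; apply: le_lt_trans cg _.
    by apply: le_lt_trans nd1; rewrite iN1 lerDl ltW.
  rewrite opprD addNKr normrN gtr0_norm//; exact: le_lt_trans nd1.
have h2 : `|Dt W (y, t) - Dt W (y, c2)| < d / 2.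
  apply: hDt => //=; first by rewrite subrr normr0.
  rewrite distrC ger0_norm ?subr_ge0//; apply: le_lt_trans nd2.
  by apply: le_trans ile; rewrite lerBlDl.
have h3 : `|dot (Dy W (y, t) - Dy W (y + c1 *: g, t + i)) g| <= d / 2.
  apply: le_trans (normr_dot _ _) _.
  apply: (@le_trans _ _ (m%:R * e1 * N)).
    by rewrite ler_pM// ?mulr_ge0// ler_wpM2l// ltW.
  rewrite /e1 mulrAC mulrA ler_pdivrMr ?mulr_gt0//.
  have : 0 <= m%:R * N by rewrite mulr_ge0.
  exact: uniform_arith.
move: h3 h2; rewrite dotBl => /ler_normlP[_ h3] /ltr_normlP[_ h2].
move: (dot _ _) (dot _ _) (Dt _ _) (Dt _ _) h3 h2 => a1 a2 a3 a4 h3 h2.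
exact: near_arith.
Qed.

(** First-order upper bound of the step weight; the Isaacs inequality is exactly
what makes its integral at most 1 ([Rintegral_near_bound]). *)
Definition near_bound p (x : borel_rV R h) : R :=
  \sum_k rho k p * (expR (ln (mgf (abar k p) 0) - r k p) *
    mgf_integrand G (- abar k p) (- s k p) x).

Lemma integrable_near_bound p : intg (near_bound p).
Proof.
apply: integrable_bigsum => k; apply/integrable_scale/integrable_scale.
exact: integrable_mgf_integrand.
Qed.

Lemma Rintegral_near_bound p : strip p -> \int[eta]_x near_bound p x <= 1.
Proof.
move=> sp.
have im k : intg (mgf_integrand G (- abar k p) (- s k p)).
  exact: integrable_mgf_integrand.
have i1 k : intg (fun x => expR (ln (mgf (abar k p) 0) - r k p) *
    mgf_integrand G (- abar k p) (- s k p) x).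
  exact: (integrable_scale _ (im k)).
rewrite /near_bound Rintegral_sum//; last first.
  by move=> k; exact: (integrable_scale _ (i1 k)).
rewrite -(rho1 sp); apply: ler_sum => k _.
rewrite (RintegralZl _ _ (i1 k))// (RintegralZl _ _ (im k))//.
rewrite -[leRHS]mulr1 ler_wpM2l ?rho0//.
have -> : \int[eta]_x mgf_integrand G (- abar k p) (- s k p) x =
    expR (ln (mgf (- abar k p) (- s k p))) by rewrite (expR_ln_mgf cG H_fin).
rewrite -expRD.
rewrite -expR0 ler_expR addrAC subr_le0 addrC.
exact: isaacs.
Qed.

Lemma step_weight_near (n : nat) y t x d : strip (y, t) ->
  dot (Dy W (y, t)) (G x) + Dt W (y, t) - d <= increment n y t (G x) ->
  step_weight n y t x <= expR d * near_bound (y, t) x.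
Proof.
move=> sp hd; set p := (y, t) in sp hd *.
have l0 : 0 <= (mixture_density p x)^-1 by rewrite invr_ge0 ltW// mixture_density_gt0.
have E : dot (Dy W p) (G x) + Dt W p = \sum_k rho k p * (r k p + dot (s k p) (G x)).
  rewrite DyE// DtE// addrC; under [RHS]eq_bigr do rewrite mulrDr.
  rewrite big_split /=; congr (_ + _).
  rewrite (big_morph (fun u => dot u (G x)) (fun u v => dotDl u v (G x)) (dot0l (G x))).
  by apply: eq_bigr => k _; rewrite dotZl.
apply: (@le_trans _ _ (expR d * (expR (- \sum_k rho k p * (r k p + dot (s k p) (G x)))
    * (mixture_density p x)^-1))).
  rewrite mulrA -expRD ler_wpM2r// ler_expR -E.
  by rewrite lerNl opprB -/p.
rewrite ler_wpM2l ?expR_ge0// mixture_densityE.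
apply: le_trans (expR_div_mixture _ _ _ (rho1 sp)) _; first by move=> k; exact: rho0.
apply: ler_sum => k _; rewrite ler_wpM2l ?rho0// /mgf_integrand -expRD ler_expR.
rewrite !dotNl le_eqVlt; apply/orP; left; apply/eqP; ring.
Qed.

(** Where |G(x)| <= N the weight is at most e^(e/2) times [near_bound], whose
integral is at most 1; elsewhere it is at most e^-N times the envelope, and N is
chosen so that this contribution fits in the gap e^e - e^(e/2). *)
Lemma Rintegral_step_weight_near (b e : R) : 0 < e ->
  \forall n \near \oo, forall y t, (0 < n)%N -> 0 <= t -> t + n%:R^-1 <= 1 ->
    `|y| <= b -> \int[eta]_x step_weight n y t x <= expR e.
Proof.
move=> e0; have [E [iE E0 hE]] := step_weight_envelope.
set D := \int[eta]_x E x.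
have D0 : 0 <= D by apply: Rintegral_ge0.
pose gap := expR e - expR (e / 2).
have gap0 : 0 < gap by rewrite subr_gt0 ltr_expR; lra.
(* e^N >= 1 + N >= D / gap, so that e^-N D <= gap. *)
pose N := D / gap.
have N0 : 0 <= N by rewrite divr_ge0// ltW.
have e20 : 0 < e / 2 by rewrite divr_gt0.
have := increment_near b N0 e20; apply: filterS => n hn y t n0 t0 tn yb.
have n0R : (0 : R) < n%:R^-1 by rewrite invr_gt0 ltr0n.
have sp : strip (y, t).
  split => //=; rewrite in_itv /= t0/=; apply: le_trans tn.
  by rewrite lerDl ltW.
have inb : intg (fun x => expR (e / 2) * near_bound (y, t) x).
  exact/integrable_scale/integrable_near_bound.
have iNE : intg (fun x => expR (- N) * E x).
  exact: integrable_scale.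
have iub : intg (fun x => expR (e / 2) * near_bound (y, t) x + expR (- N) * E x).
  exact: integrable_add.
have nb0 x : 0 <= near_bound (y, t) x.
  by apply: sumr_ge0 => k _; rewrite mulr_ge0 ?rho0// mulr_ge0 ?expR_ge0.
have le_ub x : 0 <= step_weight n y t x <=
    expR (e / 2) * near_bound (y, t) x + expR (- N) * E x.
  rewrite step_weight_ge0//=.
  have [GN|NG] := leP `|G x| N.
    rewrite -[leLHS]addr0; apply: lerD; last by rewrite mulr_ge0 ?expR_ge0.
    by apply: step_weight_near => //; exact: hn.
  rewrite -[leLHS]add0r; apply: lerD; first by rewrite mulr_ge0 ?expR_ge0.
  rewrite expRN mulrC ler_pdivlMr ?expR_gt0//; apply: le_trans (hE n y t x n0 t0 tn).
  by rewrite ler_wpM2l ?step_weight_ge0// ler_expR ltW.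
have isw : intg (step_weight n y t).
  by apply: integrable_le le_ub iub; exact: measurable_step_weight.
apply: (@le_trans _ _ (expR (e / 2) + expR (- N) * D)).
  apply: (@le_trans _ _ (\int[eta]_x
      (expR (e / 2) * near_bound (y, t) x + expR (- N) * E x))).
    by apply: le_Rintegral => // x _; have /andP[] := le_ub x.
  rewrite RintegralD// RintegralZl//; last exact: integrable_near_bound.
  rewrite RintegralZl// lerD2r -[leRHS]mulr1 ler_wpM2l ?expR_ge0//.
  exact: Rintegral_near_bound.
rewrite -lerBrDl -/gap expRN mulrC ler_pdivrMr ?expR_gt0//.
rewrite mulrC -ler_pdivrMr//; apply: le_trans (expR_ge1Dx _).
by rewrite -/N lerDr.
Qed.

End one_step.

(** * The potential *)

Section potential.
Context {R : realType} {h m : nat}.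
Variables (eta : probability (borel_rV R h) R) (G : 'rV[R]_h -> 'rV[R]_m).
Hypotheses (cG : continuous G)
  (H_fin : forall a alpha, (logmgf eta G a alpha < +oo)%E).
Variables (K : nat) (W : 'rV[R]_m * R -> R)
  (rho : 'I_K -> 'rV[R]_m * R -> R) (abar : 'I_K -> 'rV[R]_m * R -> 'rV[R]_h).
Local Notation intg f := (eta.-integrable setT (EFin \o f)).

(** The second exponential compensates for the far region |y| > C, where the
first-order expansion of W is not uniform. *)
Definition potential (n : nat) (e C : R) (j : nat) (y : 'rV[R]_m) : R :=
  expR (- (n%:R * W (y, j%:R / n%:R))) *
  (expR ((n%:R - j%:R) * e) + expR (n%:R * (`|y| - C) + (n%:R - j%:R) * C)).

Hypothesis gs : generalized_subsolution eta G W rho abar.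

Lemma potential_ge0 n e C j y : 0 <= potential n e C j y.
Proof. by rewrite mulr_ge0 ?expR_ge0// addr_ge0 ?expR_ge0. Qed.

Lemma subsolution_mixture_gt0 p x : strip p -> 0 < mixture_density eta G rho abar p x.
Proof.
move=> sp.
exact: (mixture_density_gt0 cG H_fin abar (gs_rho_ge0 gs) (gs_rho_sum1 gs)).
Qed.

(** With D the integral of the envelope, C is chosen so that 2 D <= e^C and
e <= C.  The second term of the potential grows by at most D <= e^C in one step.
The first grows by at most e^e if |y| <= C; if |y| > C it may grow by D, but it
is then below the second, and 2 D <= e^C accounts for both. *)
Lemma potential_decreases (e : R) : 0 < e -> exists C, \forall n \near \oo,
  forall j y, (j < n)%N ->
  (\int[eta]_x (potential n e C j.+1 (y + n%:R^-1 *: G x) *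
      (mixture_density eta G rho abar (y, (j%:R / n%:R)%R) x)^-1)%:E <=
   (potential n e C j y)%:E)%E.
Proof.
move=> e0.
have [rho0 rho1 C1 [r [s [DtE DyE isa [M bnd'] _]]]] := gs.
have isaacs k p : strip p ->
  ln (mgf eta G (- abar k p) (- s k p)) + ln (mgf eta G (abar k p) 0) <= r k p.
  move=> sp; have := isa k p sp.
  have := hamiltonian_inf_le cG H_fin (s k p) (abar k p).
  move=> hle /le_trans /(_ (leeD2l (r k p)%:E hle)).
  by rewrite -EFinD lee_fin; exact: isaacs_arith.
have bnd k p : strip p -> [/\ `|r k p| <= `|M|, `|s k p| <= `|M| & `|abar k p| <= `|M|].
  move=> sp; have [h1 h2 _ h4] := bnd' k p sp.
  by split; apply: le_trans (ler_norm M).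
have [E [iE E0 hE]] := step_weight_envelope cG H_fin rho0 rho1 C1 DtE DyE (normr_ge0 M) bnd.
set D := \int[eta]_x E x.
have D0 : 0 <= D by apply: Rintegral_ge0.
pose C := 2 * D + e.
have eC : e <= C by rewrite lerDr mulr_ge0.
have DC : 2 * D <= expR C.
  by apply: le_trans (expR_ge1Dx _); rewrite /C; move: D0 e0; exact: expR_bound_arith.
exists C.
have := Rintegral_step_weight_near cG H_fin rho0 rho1 C1 DtE DyE isaacs (normr_ge0 M) bnd C e0.
apply: filterS => n hn j y jn.
have n0 : (0 < n)%N by apply: leq_ltn_trans jn.
have n0R : (0 : R) < n%:R by rewrite ltr0n.
have t0 : 0 <= j%:R / n%:R :> R by rewrite divr_ge0.
have tE : j.+1%:R / n%:R = j%:R / n%:R + n%:R^-1 :> R.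
  by rewrite -natr1 mulrDl mul1r.
have tn : j%:R / n%:R + n%:R^-1 <= 1 :> R.
  by rewrite -tE ler_pdivrMr// mul1r ler_nat.
set t := j%:R / n%:R in t0 tE tn *.
pose sw := step_weight eta G W rho abar n y t.
have sw0 x : 0 <= sw x by exact: (step_weight_ge0 cG H_fin W abar rho0 rho1 y n0 t0 tn).
have msw : measurable_fun setT sw.
  exact: (measurable_step_weight cG H_fin abar rho0 rho1 C1 y n0 t0 tn).
have mnG : measurable_fun setT (fun x : borel_rV R h => expR `|G x|).
  apply: measurableT_comp => //; apply: (measurableT_comp (@measurable_norm_rV _ _)).
  exact: continuous_measurable_rVrV.
have iswG : intg (fun x => sw x * expR `|G x|).
  apply: integrable_le iE; first exact: measurable_funM.
  by move=> x; rewrite mulr_ge0 ?expR_ge0//= hE.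
have le_sw x : 0 <= sw x <= sw x * expR `|G x|.
  by rewrite sw0 /= ler_peMr// -expR0 ler_expR.
have isw : intg sw by exact: integrable_le iswG.
set I2 := \int[eta]_x (sw x * expR `|G x|).
set I1 := \int[eta]_x sw x.
have I2D : I2 <= D by apply: le_Rintegral => // x _; exact: hE.
have I12 : I1 <= I2 by apply: le_Rintegral => // x _; have /andP[] := le_sw x.
have I10 : 0 <= I1 by apply: Rintegral_ge0.
pose A := expR ((n%:R - j.+1%:R) * e).
pose B := expR (n%:R * (`|y| - C) + (n%:R - j.+1%:R) * C).
pose w := expR (- (n%:R * W (y, t))).
pose ub x := w * (A * sw x + B * (sw x * expR `|G x|)).
have iub : intg ub by apply/integrable_scale/integrable_add; exact: integrable_scale.
have le_ub x : potential n e C j.+1 (y + n%:R^-1 *: G x) *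
    (mixture_density eta G rho abar (y, t) x)^-1 <= ub x.
  rewrite /potential tE; set z := y + _.
  have -> : expR (- (n%:R * W (z, t + n%:R^-1))) =
      w * expR (- increment W n y t (G x)).
    by rewrite -expRD /increment -/z; congr expR; ring.
  have -> : ub x = w * (sw x * (A + B * expR `|G x|)) by rewrite /ub; ring.
  rewrite -/A; set B' := expR (_ + _); rewrite [leLHS](_ : _ = w * (sw x * (A + B'))).
    rewrite ler_wpM2l ?expR_ge0// ler_wpM2l// lerD2l -expRD ler_expR addrAC lerD2r.
    rewrite -[`|G x|](mulVKf (lt0r_neq0 n0R)) -mulrDr ler_wpM2l ?(ltW n0R)//.
    rewrite addrAC lerD2r; apply: le_trans (ler_normD _ _) _.
    by rewrite normrZ ger0_norm// invr_ge0 ltW.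
  by rewrite /sw /step_weight; ring.
apply: (@le_trans _ _ (\int[eta]_x (ub x)%:E)%E).
  apply: ge0_integral_monotone => x _; rewrite !lee_fin le_ub andbT.
  rewrite mulr_ge0 ?potential_ge0// invr_ge0 ltW// subsolution_mixture_gt0//.
  split => //=; rewrite in_itv /= t0 (le_trans _ tn)// lerDl invr_ge0//.
rewrite -[leLHS]fineK; last exact: integrable_fin_num.
rewrite lee_fin -/(Rintegral eta setT ub).
rewrite RintegralZl//; last by apply/integrable_add; exact: integrable_scale.
rewrite RintegralD//; try exact: integrable_scale.
rewrite !RintegralZl// -/I1 -/I2 /potential -/t -/w ler_wpM2l ?expR_ge0//.
have nj : n%:R - j%:R = (n%:R - j.+1%:R) + 1 :> R by rewrite -natr1; ring.
rewrite nj mulrDl mul1r [(_ + 1) * C]mulrDl mul1r addrA [expR (_ + e)]expRD.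
rewrite [expR (_ + C)]expRD -/A -/B.
have [yC|Cy] := leP `|y| C.
  apply: lerD; rewrite ler_wpM2l ?expR_ge0//; first exact: hn.
  by apply: le_trans I2D _; apply: le_trans DC; rewrite ler_peMl// ler1n.
have AB : A <= B.
  rewrite ler_expR -[leLHS]add0r; apply: lerD.
    by rewrite mulr_ge0// subr_ge0 ltW.
  by rewrite ler_wpM2l// subr_ge0 ler_nat.
apply: (@le_trans _ _ (B * (2 * D))).
  rewrite mulr_natl mulr2n mulrDr; apply: lerD; apply: ler_pM => //; rewrite ?expR_ge0//.
    exact: le_trans I2D.
  exact: le_trans I12.
by rewrite -[leLHS]add0r; apply: lerD; rewrite ?mulr_ge0 ?expR_ge0// ler_wpM2l ?expR_ge0.
Qed.

End potential.

(** * The scheme as a supermartingale *)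

Section joint_measurability.
Context {R : realType} {h m : nat}.
Variables (eta : probability (borel_rV R h) R) (G : 'rV[R]_h -> 'rV[R]_m).
Hypotheses (cG : continuous G)
  (H_fin : forall a alpha, (logmgf eta G a alpha < +oo)%E).

(** Tonelli's theorem gives measurability of the parametric integral. *)
Lemma measurable_mgf1 : measurable_fun setT (fun a : borel_rV R h => mgf eta G a 0).
Proof.
pose f (z : borel_rV R h * borel_rV R h) := (mgf_integrand G z.1 0 z.2)%:E.
have mf : measurable_fun setT f.
  apply/measurable_EFinP/measurableT_comp => //; apply: measurable_funD.
    by apply: (@measurable_dot R _ _ h fst snd).
  rewrite (_ : (fun _ => _) = cst 0); first exact: measurable_cst.
  by apply/funext => z; rewrite dot0l.
apply: (measurableT_comp (fine_measurable measurableT)).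
apply: (measurable_fun_fubini_tonelli_F (m2 := eta) f) => //.
by move=> z; rewrite lee_fin expR_ge0.
Qed.

Context {d : measure_display} {T : measurableType d}.

Lemma measurable_tilt_density (a x : T -> borel_rV R h) :
  measurable_fun setT a -> measurable_fun setT x ->
  measurable_fun setT (fun t => tilt_density eta G (a t) (x t)).
Proof.
move=> ma mx; under eq_fun do rewrite (tilt_densityE cG H_fin).
apply: measurableT_comp => //; apply: measurable_funB.
  exact: measurable_dot.
apply: measurableT_comp; first exact: measurable_ln.
exact: (measurableT_comp measurable_mgf1).
Qed.

Variables (K : nat) (rho : 'I_K -> 'rV[R]_m * R -> R)
  (abar : 'I_K -> 'rV[R]_m * R -> 'rV[R]_h) (t : R).
Hypotheses (crho : forall k, continuous (fun y => rho k (y, t)))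
  (cabar : forall k, continuous (fun y => abar k (y, t))).

Lemma measurable_mixture_density_joint (y : T -> borel_rV R m) (x : T -> borel_rV R h) :
  measurable_fun setT y -> measurable_fun setT x ->
  measurable_fun setT (fun u => mixture_density eta G rho abar (y u, t) (x u)).
Proof.
move=> my mx; apply: measurable_sum => k; apply: measurable_funM.
  exact: (measurableT_comp (continuous_measurable_rV (@crho k))).
apply: measurable_tilt_density => //.
exact: (measurableT_comp (continuous_measurable_rVrV (@cabar k))).
Qed.

End joint_measurability.

Section sampling_step.
Context {R : realType} {h m : nat}.
Variables (eta : probability (borel_rV R h) R) (G : 'rV[R]_h -> 'rV[R]_m).
Hypotheses (cG : continuous G)
  (H_fin : forall a alpha, (logmgf eta G a alpha < +oo)%E).
Variables (K : nat) (W : 'rV[R]_m * R -> R)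
  (rho : 'I_K -> 'rV[R]_m * R -> R) (abar : 'I_K -> 'rV[R]_m * R -> 'rV[R]_h).
Hypothesis gs : generalized_subsolution eta G W rho abar.
Variables (n : nat) (d : measure_display) (Omega : measurableType d)
  (P : probability Omega R) (X : nat -> {RV P >-> borel_rV R h})
  (I : nat -> Omega -> 'I_K).
Hypotheses (n0 : (0 < n)%N) (ss : sampling_scheme eta G rho abar n X I).

Local Notation Y := (Ybar G n X).
Local Notation density := (mixture_density eta G rho abar).

(** The square of the likelihood ratio accumulated over the first j steps. *)
Definition likelihood2 (j : nat) (w : Omega) : R :=
  \prod_(0 <= i < j) (density (state G n X i w) (X i.+1 w))^-1 ^+ 2.

Lemma likelihood2_ge0 j w : 0 <= likelihood2 j w.
Proof. by apply: prodr_ge0 => i _; rewrite sqr_ge0. Qed.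

Lemma grid_strip j z : (j <= n)%N -> strip (z : 'rV[R]_m, j%:R / n%:R : R).
Proof.
move=> jn; split => //=; rewrite in_itv /= divr_ge0//=.
by rewrite ler_pdivrMr ?ltr0n// mul1r ler_nat.
Qed.

Let rho_cont j k : (j <= n)%N -> continuous (fun z => rho k (z, j%:R / n%:R)).
Proof.
move=> jn; have [r [s [_ _ _ _ /(_ k)[_ _ c _]]]] := gs_rs gs.
apply: strip_slice_continuous c; have [_ /=] := grid_strip 0 jn.
by rewrite in_itv.
Qed.

Let abar_cont j k : (j <= n)%N -> continuous (fun z => abar k (z, j%:R / n%:R)).
Proof.
move=> jn; have [r [s [_ _ _ _ /(_ k)[_ _ _ c]]]] := gs_rs gs.
apply: strip_slice_continuous c; have [_ /=] := grid_strip 0 jn.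
by rewrite in_itv.
Qed.

Section measurable_history.
Context {d' : measure_display} {T : measurableType d'} (phi : T -> Omega) (j : nat).
Hypotheses (jn : (j <= n)%N)
  (mX : forall i, (0 < i <= j)%N -> measurable_fun setT (X i \o phi)).

(** The map phi allows the same argument for the whole probability space and for
its sub-sigma-algebra generated by X_1, ..., X_j. *)
Lemma measurable_Ybar i : (i <= j)%N ->
  measurable_fun setT (Y i \o phi : T -> borel_rV R m).
Proof.
elim: i => [_|i ih ij]; first exact: measurable_cst.
apply: (@measurable_rVD _ _ _ _ (Y i \o phi)); first by apply: ih; exact: ltnW.
apply: (@measurable_rVZ _ _ _ _ _ (G \o (X i.+1 \o phi))).
by apply: measurableT_comp; [exact: continuous_measurable_rVrV|exact: mX].
Qed.

Lemma measurable_likelihood2 i : (i <= j)%N ->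
  measurable_fun setT (likelihood2 i \o phi).
Proof.
move=> ij; apply: measurable_prod => k; rewrite mem_index_iota => /andP[_ ki].
have kn : (k <= n)%N by rewrite (leq_trans (ltnW ki))// (leq_trans ij).
apply: measurable_funX; apply: measurable_inv_gt0.
  apply: (measurable_mixture_density_joint cG H_fin (t := k%:R / n%:R)).
  - by move=> l; exact: rho_cont.
  - by move=> l; exact: abar_cont.
  - by apply: measurable_Ybar; rewrite (leq_trans (ltnW ki)).
  - by apply: mX; rewrite /= (leq_trans ki).
by move=> t; apply: (subsolution_mixture_gt0 cG H_fin gs); exact: grid_strip.
Qed.

End measurable_history.

Section one_sample.
Variables (j : nat).
Hypothesis jn : (j < n)%N.

Let hist w : borel_rV R m * R := (Y j w, likelihood2 j w).

Let mhist : measurable_fun setT hist.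
Proof.
have mX i : (0 < i <= j)%N -> measurable_fun setT (X i \o id) by [].
apply/measurable_fun_pair.
- exact: (measurable_Ybar mX (leqnn j)).
- exact: (measurable_likelihood2 (ltnW jn) mX (leqnn j)).
Qed.

Let past_hist A : measurable A -> past X j (hist @^-1` A).
Proof.
move=> mA.
(* On the sigma-algebra of the past, X_1, ..., X_j are measurable by construction. *)
pose gen := [set A | exists i (B : set (borel_rV R h)),
        [/\ (0 < i <= j)%N, measurable B & A = X i @^-1` B]].
pose T := g_sigma_algebraType gen.
have mX i : (0 < i <= j)%N ->
    measurable_fun [set: T] (X i \o (id : T -> Omega)).
  move=> ij _ B mB; rewrite setTI; apply: sub_sigma_algebra.
  by exists i, B.
have mh : measurable_fun [set: T] (hist : T -> borel_rV R m * R).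
  apply/measurable_fun_pair.
  - exact: (measurable_Ybar mX (leqnn j)).
  - exact: (measurable_likelihood2 (ltnW jn) mX (leqnn j)).
by have := mh measurableT A mA; rewrite setTI.
Qed.

(** The conditioning lemma is applied to the pair made of Y_j and the squared
likelihood ratio, through which alone the past enters. *)
Lemma sampling_expectation (f : borel_rV R m -> borel_rV R h -> R) :
  measurable_fun setT (fun z : borel_rV R m * borel_rV R h => f z.1 z.2) ->
  (forall y x, 0 <= f y x) ->
  (\int[P]_w (likelihood2 j w * f (Y j w) (X j.+1 w))%:E =
   \int[P]_w ((likelihood2 j w)%:E *
     \int[eta]_x (f (Y j w) x * density (state G n X j w) x)%:E))%E.
Proof.
move=> mf f0.
pose S : {RV P >-> (borel_rV R m * R)%type} :=
  HB.pack hist (isMeasurableFun.Build _ _ _ _ _ mhist).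
pose t : R := j%:R / n%:R.
pose rho' k (z : borel_rV R m * R) := rho k (z.1, t).
pose q k (z : (borel_rV R m * R) * borel_rV R h) :=
  tilt_density eta G (abar k (z.1.1, t)) z.2.
(* The absolute value makes the function nonnegative on the whole product space. *)
pose F (z : (borel_rV R m * R) * borel_rV R h) : \bar R :=
  (`|z.1.2| * f z.1.1 z.2)%:E.
have mF : measurable_fun setT F.
  apply/measurable_EFinP; apply: measurable_funM.
    by apply: measurableT_comp => //; apply: measurableT_comp.
  apply: (measurableT_comp (g := fun z : (borel_rV R m * R) * borel_rV R h => (z.1.1, z.2)) mf).
  apply/measurable_fun_pair => //.
  by apply: measurableT_comp.
have F0 z : (0 <= F z)%E by rewrite lee_fin mulr_ge0.
have := @expectation_conditional_law _ _ _ _ _ _ _ P eta S (X j.+1) K (I j) rho' q.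
move=> /(_ _ _ _ _ _ _ _ F mF F0) E.
have L0 w : `|likelihood2 j w| = likelihood2 j w by rewrite ger0_norm// likelihood2_ge0.
transitivity (\int[P]_w F (S w, X j.+1 w))%E.
  by apply: eq_integral => w _; rewrite /F /= L0.
have jn' : (j <= n)%N := ltnW jn.
have mrho' k : measurable_fun setT (rho' k).
  have mk := continuous_measurable_rV (@rho_cont j k jn').
  exact: (measurableT_comp (f := (fun z => rho k (z, t)) : borel_rV R m -> R) mk).
have m11 : measurable_fun setT
    (fun z : (borel_rV R m * R) * borel_rV R h => z.1.1).
  by apply: measurableT_comp.
have mq k : measurable_fun setT (q k).
  apply: (measurable_tilt_density cG H_fin) => //.
  have mk := continuous_measurable_rVrV (@abar_cont j k jn').
  exact: (measurableT_comp (f := (fun z => abar k (z, t)) : borel_rV R m -> borel_rV R h) mk).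
have mD : measurable_fun setT (fun z : borel_rV R m * borel_rV R h => density (z.1, t) z.2).
  apply: (measurable_mixture_density_joint cG H_fin (t := t)) => //.
  - by move=> k; exact: rho_cont.
  - by move=> k; exact: abar_cont.
have D0 y x : 0 <= density (y, t) x.
  by apply: ltW; apply: (subsolution_mixture_gt0 cG H_fin gs); exact: grid_strip.
rewrite E//.
- apply: eq_integral => w _; rewrite -ge0_integralZl//.
  + by apply: eq_integral => x _; rewrite /F /= L0 -!EFinM mulrA.
  + have mpair : measurable_fun setT
        (fun x : borel_rV R h => (Y j w : borel_rV R m, x)).
      exact/measurable_fun_pair.
    apply/measurable_EFinP; apply: measurable_funM.
      exact: (measurableT_comp mf mpair).
    exact: (measurableT_comp mD mpair).
  + by move=> x _; rewrite lee_fin mulr_ge0//; exact: D0.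
  + by rewrite lee_fin likelihood2_ge0.
- by move=> k; exact: (ss_index_measurable ss).
- by move=> k z; apply: (gs_rho_ge0 gs); exact: grid_strip.
- by move=> k z; exact: expR_ge0.
- by move=> k A mA; exact: (ss_index_law ss k jn (past_hist mA)).
- by move=> k A B mA mB; exact: (ss_sample_law ss k jn (past_hist mA) mB).
Qed.

End one_sample.

Lemma likelihood2_recr j w : likelihood2 j.+1 w =
  likelihood2 j w * (density (state G n X j w) (X j.+1 w))^-1 ^+ 2.
Proof. by rewrite /likelihood2 big_nat_recr. Qed.

Lemma measurable_potential e C j : (j <= n)%N ->
  measurable_fun setT (potential W n e C j : borel_rV R m -> R).
Proof.
move=> jn; apply: measurable_funM.
  apply: measurableT_comp => //; apply: measurable_funN; apply: measurable_funM => //.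
  apply: continuous_measurable_rV; have [cW _ _ _ _] := gs_C1 gs.
  apply: strip_slice_continuous cW; have [_ /=] := grid_strip 0 jn.
  by rewrite in_itv.
apply: measurable_funD => //; apply: measurableT_comp => //.
apply: measurable_funD => //; apply: measurable_funM => //.
by apply: measurable_funB => //; exact: measurable_norm_rV.
Qed.

Definition expected_potential e C j :=
  (\int[P]_w (likelihood2 j w * potential W n e C j (Y j w))%:E)%E.

Section supermartingale.
Variables (e C : R).
Hypothesis step : forall j y, (j < n)%N ->
  (\int[eta]_x (potential W n e C j.+1 (y + n%:R^-1 *: G x) *
      (density (y, (j%:R / n%:R)%R) x)^-1)%:E <=
   (potential W n e C j y)%:E)%E.

(** One of the two inverse densities contributed by the step cancels the sampling
density, and the other one is the one present in [step]. *)
Lemma expected_potential_nonincreasing j : (j < n)%N ->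
  (expected_potential e C j.+1 <= expected_potential e C j)%E.
Proof.
move=> jn; pose t : R := j%:R / n%:R.
have D0 y x : 0 < density (y, t) x.
  by apply: (subsolution_mixture_gt0 cG H_fin gs); apply: grid_strip; exact: ltnW.
pose f (y : borel_rV R m) (x : borel_rV R h) : R :=
  (density (y, t) x)^-1 ^+ 2 * potential W n e C j.+1 (y + n%:R^-1 *: G x).
have mD : measurable_fun setT (fun z : borel_rV R m * borel_rV R h => density (z.1, t) z.2).
  apply: (measurable_mixture_density_joint cG H_fin (t := t)) => //.
  - by move=> k; apply: rho_cont; exact: ltnW.
  - by move=> k; apply: abar_cont; exact: ltnW.
have mf : measurable_fun setT (fun z : borel_rV R m * borel_rV R h => f z.1 z.2).
  apply: measurable_funM.
    by apply: measurable_funX; apply: measurable_inv_gt0.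
  apply: (measurableT_comp (measurable_potential e C jn)).
  apply: (@measurable_rVD _ _ _ _ fst) => //.
  apply: (@measurable_rVZ _ _ _ _ _ (fun z : borel_rV R m * borel_rV R h => G z.2)).
  by apply: (measurableT_comp (continuous_measurable_rVrV cG)).
have f0 y x : 0 <= f y x by rewrite mulr_ge0 ?sqr_ge0 ?potential_ge0.
rewrite /expected_potential; under eq_integral do rewrite likelihood2_recr -mulrA.
rewrite [leLHS](sampling_expectation jn mf f0).
apply: ge0_integral_monotone => w _.
rewrite mule_ge0 ?lee_fin ?likelihood2_ge0//=; last first.
  by apply: integral_ge0 => x _; rewrite lee_fin mulr_ge0 ?f0// ltW ?D0.
rewrite EFinM; apply: lee_wpmul2l; first by rewrite lee_fin likelihood2_ge0.
apply: le_trans (step _ jn); rewrite le_eqVlt; apply/orP; left; apply/eqP.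
apply: eq_integral => x _; congr _%:E; rewrite /f /state -/t.
have := D0 (Y j w) x; move: (density _ _) (potential _ _ _ _ _ _) => a b a0.
by rewrite expr2 -!mulrA [b * a]mulrC (mulKf (lt0r_neq0 a0)) mulrC.
Qed.

Lemma expected_potential_le j : (j <= n)%N ->
  (expected_potential e C j <= (potential W n e C 0 0)%:E)%E.
Proof.
elim: j => [_|j ih jn].
  rewrite /expected_potential /likelihood2.
  under eq_integral do rewrite big_geq// mul1r /=.
  by rewrite integral_cst// [X in (_ * X)%E](probability_setT P) mule1.
by apply: le_trans (ih (ltnW jn)); exact: expected_potential_nonincreasing.
Qed.

Variable F : 'rV[R]_m -> \bar R.
Hypotheses (FNy : forall y, (-oo < F y)%E)
  (WF : forall y, ((W (y, 1))%:E <= 2%:E * F y)%E).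

(** Where F is infinite the estimator vanishes; elsewhere the terminal condition
W <= 2 F applies, and the bracket of the potential is at least 1 at time n. *)
Lemma estimator_sqr_le w :
  estimator eta G rho abar n X F w ^+ 2 <=
  likelihood2 n w * potential W n e C n (Y n w).
Proof.
rewrite /estimator exprMn [leRHS]mulrC.
have -> : (\prod_(0 <= j < n) (\sum_(k < K) rho k (state G n X j w) *
    tilt_density eta G (abar k (state G n X j w)) (X j.+1 w))^-1) ^+ 2 =
    likelihood2 n w by rewrite -prodrXl.
rewrite ler_wpM2r ?likelihood2_ge0//.
set y := Y n w; have := WF y; have := FNy y.
have nn : n%:R / n%:R = 1 :> R by rewrite divff// pnatr_eq0 -lt0n.
have n0R : (0 : R) < n%:R by rewrite ltr0n.
case: (F y) => [r _||//].
  rewrite -EFinM lee_fin /= => Wr; rewrite -expRM_natl /potential nn.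
  apply: (@le_trans _ _ (expR (- (n%:R * W (y, 1))))).
    by rewrite ler_expR mulrN lerN2 mulrCA ler_wpM2l// ltW.
  rewrite ler_peMr ?expR_ge0// subrr !mul0r expR0 lerDl expR_ge0//.
move=> _ _; rewrite gt0_muley ?lte_fin//= expr0n /=; exact: potential_ge0.
Qed.

Lemma second_moment_le :
  ('E_P[fun w => (estimator eta G rho abar n X F w ^+ 2)%R] <=
   (potential W n e C 0 0)%:E)%E.
Proof.
rewrite unlock; apply: le_trans (expected_potential_le (leqnn n)).
apply: ge0_integral_monotone => w _.
by rewrite !lee_fin sqr_ge0 estimator_sqr_le.
Qed.

End supermartingale.

End sampling_step.

(** * Asymptotics *)

Section asymptotics.
Context {R : realType}.

Lemma limn_einf_ge (u : (\bar R)^nat) (l : \bar R) :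
  (\forall n \near \oo, (l <= u n)%E) -> (l <= limn_einf u)%E.
Proof.
move=> [N _ lu]; rewrite limn_einf_lim; apply: lime_ge; first exact: is_cvg_einfs.
exists N => // k /= Nk; apply: le_ereal_inf_tmp => _ [i /= ki <-].
by apply: lu; exact: leq_trans ki.
Qed.

Lemma log_rate_ge (n : nat) (E : \bar R) (c : R) : (0 < n)%N -> (0 <= E)%E ->
  (E <= (expR (n%:R * c))%:E)%E -> ((- c)%:E <= - (n%:R^-1)%:E * lne E)%E.
Proof.
move=> n0 E0 Ec; have n0R : (0 : R) < n%:R by rewrite ltr0n.
have lE : (lne E <= (n%:R * c)%:E)%E.
  rewrite -(expRK (n%:R * c)) -lne_EFin ?expR_gt0// lee_lne//.
    by rewrite in_itv /= E0 leey.
  by rewrite in_itv /= lee_fin expR_ge0 leey.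
rewrite mulNe EFinN leeN2.
have -> : c%:E = ((n%:R^-1)%:E * (n%:R * c)%:E)%E.
  by rewrite -EFinM mulKf// gt_eqF.
by apply: lee_wpmul2l => //; rewrite lee_fin invr_ge0 ltW.
Qed.

Lemma potential_origin_le m (W : 'rV[R]_m * R -> R) (n : nat) (e C : R) : 0 <= e ->
  potential W n e C 0 0 <= expR (- (n%:R * W (0, 0)) + n%:R * e + ln 2).
Proof.
move=> e0; rewrite /potential mul0r normr0 sub0r subr0 mulrN addNr expR0.
rewrite 2!expRD lnK ?posrE// -mulrA ler_wpM2l ?expR_ge0//.
rewrite mulr_natr mulr2n lerD2l -expR0 ler_expR mulr_ge0//.
Qed.

End asymptotics.

Theorem theorem2p2 (R : realType) (h m : nat)
    (eta : probability (borel_rV R h) R)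
    (G : 'rV[R]_h -> 'rV[R]_m) (F : 'rV[R]_m -> \bar R)
    (K : nat) (W : 'rV[R]_m * R -> R)
    (rho : 'I_K -> 'rV[R]_m * R -> R)
    (abar : 'I_K -> 'rV[R]_m * R -> 'rV[R]_h)
    (d : nat -> measure_display) (Omega : forall n, measurableType (d n))
    (P : forall n, probability (Omega n) R)
    (X : forall n, nat -> {RV (P n) >-> borel_rV R h})
    (I : forall n, nat -> Omega n -> 'I_K) :
  continuous G ->
  measurable_fun [set: borel_rV R m] (F : borel_rV R m -> \bar R) ->
  (forall y, (-oo < F y)%E) ->
  (forall a alpha, (logmgf eta G a alpha < +oo)%E) ->
  generalized_subsolution eta G W rho abar ->
  (forall y, ((W (y, 1))%:E <= 2%:E * F y)%E) ->
  (forall n, (0 < n)%N -> sampling_scheme eta G rho abar n (X n) (I n)) ->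
  ((W (0, 0))%:E <=
     limn_einf (fun n => - (n%:R^-1)%:E *
       lne 'E_(P n)[fun w => (estimator eta G rho abar n (X n) F w ^+ 2)%R]))%E.
Proof.
move=> cG _ FNy H_fin gs WF ss; apply/lee_addgt0Pr => e e0.
rewrite -leeBlDr// -EFinB; apply: limn_einf_ge.
have e20 : 0 < e / 2 by rewrite divr_gt0.
have [C step] := potential_decreases cG H_fin gs e20.
have ln2 : \forall n \near \oo, ln 2 <= n%:R * (e / 2).
  near=> n; rewrite -ler_pdivrMr//; apply: ltW.
  by near: n; exact: nbhs_infty_gtr.
near=> n.
have n0 : (0 < n)%N by near: n; exact: nbhs_infty_gt.
rewrite (_ : W (0, 0) - e = - (e - W (0, 0))); last by rewrite opprB.
apply: log_rate_ge => //.
  rewrite unlock; apply: integral_ge0 => w _; rewrite lee_fin; exact: sqr_ge0.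
have stepn : forall j y, (j < n)%N ->
  (\int[eta]_x (potential W n (e / 2) C j.+1 (y + n%:R^-1 *: G x) *
      (mixture_density eta G rho abar (y, (j%:R / n%:R)%R) x)^-1)%:E <=
   (potential W n (e / 2) C j y)%:E)%E by near: n.
apply: le_trans (second_moment_le cG H_fin gs n0 (ss n n0) stepn FNy WF) _.
rewrite lee_fin; apply: le_trans (potential_origin_le _ _ _ (ltW e20)) _.
have ln2n : ln 2 <= n%:R * (e / 2) by near: n.
rewrite ler_expR mulrBr [e in leRHS]splitr mulrDr [leRHS]addrC -addrA lerD2l.
by rewrite lerD2l.
Unshelve. all: by end_near. Qed.
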